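(* Let $\mathcal C$, $\mathcal C'$ be categories with finite colimits (with the coproduct in each written $+$), and let $(\mathcal D,\otimes)$, $(\mathcal D',\boxtimes)$ be braided monoidal categories. Let $$(F,\varphi)\colon(\mathcal C,+)\to(\mathcal D,\otimes)\quad\text{and}\quad(G,\gamma)\colon(\mathcal C',+)\to(\mathcal D',\boxtimes)$$ be lax braided monoidal functors, giving rise to the decorated cospan categories $F\mathrm{Cospan}$ and $G\mathrm{Cospan}$. Suppose we have a finite colimit-preserving functor $A\colon\mathcal C\to\mathcal C'$ with accompanying natural isomorphism $\alpha\colon A(-)+A(-)\Rightarrow A(-+-)$, a lax monoidal functor $(B,\beta)\colon(\mathcal D,\otimes)\to(\mathcal D',\boxtimes)$, and a monoidal natural transformation $$\theta\colon(B\circ F,\ B\varphi\circ\beta)\Rightarrow(G\circ A,\ G\alpha\circ\gamma)$$ between lax monoidal functors $(\mathcal C,+)\to(\mathcal D',\boxtimes)$. Then we may construct a hypergraph functor $$(T,\tau)\colon F\mathrm{Cospan}\to G\mathrm{Cospan}$$ mapping each object $X$ of $F\mathrm{Cospan}$ to $AX$, and each morphism $(X\xrightarrow{i}N\xleftarrow{o}Y,\ 1_{\mathcal D}\xrightarrow{s}FN)$ to $$\bigl(AX\xrightarrow{Ai}AN\xleftarrow{Ao}AY,\quad 1_{\mathcal D'}\xrightarrow{\beta_1}B1_{\mathcal D}\xrightarrow{Bs}BFN\xrightarrow{\theta_N}GAN\bigr).$$ Moreover, $(T,\tau)$ is a strict monoidal functor if and only if $(A,\alpha)$ is.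
   Context: $(\mathcal C,+)$ denotes $\mathcal C$ with the symmetric monoidal structure given by the coproduct, with unit the initial object $\varnothing$; similarly for $\mathcal C'$. $1_{\mathcal D}$, $1_{\mathcal D'}$ (or just $1$) denote monoidal units; $1$ also denotes identity morphisms; $\lambda$ is the left unitor and $\sigma$ the braiding; $!$ is the unique map out of $\varnothing$; $[f,g]$ is the copairing. A lax monoidal functor $(F,\varphi)$ has coherence maps $\varphi_{N,M}$ and unit map $\varphi_1$. The isomorphism $\alpha$ (with unit component $\alpha_1\colon\varnothing_{\mathcal C'}\to A\varnothing_{\mathcal C}$) is the canonical comparison isomorphism expressing that $A$ preserves finite coproducts, so $(A,\alpha)\colon(\mathcal C,+)\to(\mathcal C',+)$ is a strong symmetric monoidal functor. A monoidal functor is strict if its coherence maps are identities. The composites $B\varphi\circ\beta$ and $G\alpha\circ\gamma$ denote the usual coherence maps of composite lax monoidal functors. Decorated cospan category (for $F$; likewise for $G$). An $F$-decorated cospan from $X$ to $Y$ is a cospan $X\xrightarrow{i}N\xleftarrow{o}Y$ in $\mathcal C$ together with a morphism $s\colon 1\to FN$ in $\mathcal D$ (the decoration). A morphism $(X\xrightarrow{i}N\xleftarrow{o}Y, s)\to(X\xrightarrow{i'}N'\xleftarrow{o'}Y, s')$ is a morphism $n\colon N\to N'$ in $\mathcal C$ with $n\circ i=i'$, $n\circ o=o'$, $Fn\circ s=s'$. The category $F\mathrm{Cospan}$ has as objects the objects of $\mathcal C$ and as morphisms isomorphism classes of $F$-decorated cospans; the composite of $(X \xrightarrow{i_X} N \xleftarrow{o_Y}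 Y, s)$ and $(Y \xrightarrow{i_Y} M \xleftarrow{o_Z} Z, t)$ is the cospan $X \xrightarrow{j_N i_X} N+_YM \xleftarrow{j_M o_Z} Z$ (with $j_N,j_M$ the pushout maps) decorated by $1 \xrightarrow{\lambda^{-1}} 1\otimes 1 \xrightarrow{s\otimes t} FN\otimes FM \xrightarrow{\varphi_{N,M}} F(N+M) \xrightarrow{F[j_N,j_M]} F(N+_YM)$. The empty decoration on $N$ is $1\xrightarrow{\varphi_1}F\varnothing\xrightarrow{F!}FN$; identities are identity cospans with empty decoration. Hypergraph categories. A special commutative Frobenius monoid $(X,\mu,\delta,\eta,\epsilon)$ in a symmetric monoidal category is an object $X$ with a commutative monoid structure $(\mu,\eta)$ and a cocommutative comonoid structure $(\delta,\epsilon)$ such that $(1\otimes\mu)\circ(\delta\otimes1)=\delta\circ\mu=(\mu\otimes1)\circ(1\otimes\delta)$ and $\mu\circ\delta=1_X$. A hypergraph category is a symmetric monoidal category in which each object $X$ is equipped with a special commutative Frobenius monoid structure $(X,\mu_X,\delta_X,\eta_X,\epsilon_X)$ such that $\mu_{X\otimes Y}=(\mu_X\otimes\mu_Y)\circ(1_X\otimes\sigma_{YX}\otimes1_Y)$, $\eta_{X\otimes Y}=\eta_X\otimes\eta_Y$, $\delta_{X\otimes Y}=(1_X\otimes\sigma_{XY}\otimes1_Y)\circ(\delta_X\otimes\delta_Y)$, $\epsilon_{X\otimes Y}=\epsilon_X\otimes\epsilon_Y$. A hypergraph functor $(H,\psi)$ is a strong symmetric monoidal functor such that for every object $X$ the Frobenius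 structure on $HX$ is $(HX,\ H\mu_X\circ\psi_{X,X},\ \psi_{X,X}^{-1}\circ H\delta_X,\ H\eta_X\circ\psi_1,\ \psi_1^{-1}\circ H\epsilon_X)$. The hypergraph structure on $F\mathrm{Cospan}$ (likewise $G\mathrm{Cospan}$). The monoidal product of objects is their coproduct in $\mathcal C$, with unit $\varnothing$; the monoidal product of $(X\xrightarrow{i}N\xleftarrow{o}Y,s)$ and $(X'\xrightarrow{i'}N'\xleftarrow{o'}Y',t)$ is the cospan $X+X'\xrightarrow{i+i'}N+N'\xleftarrow{o+o'}Y+Y'$ with decoration $1\xrightarrow{\lambda^{-1}}1\otimes1\xrightarrow{s\otimes t}FN\otimes FN'\xrightarrow{\varphi_{N,N'}}F(N+N')$. View a morphism $f\colon X\to Y$ of $\mathcal C$ as the cospan $X\xrightarrow{f}Y\xleftarrow{1}Y$ with empty decoration. The associator, unitors and braiding are the images in this sense of those of $(\mathcal C,+)$. The Frobenius structure on $X$ has $\mu_X$, $\eta_X$ the images of $[1_X,1_X]\colon X+X\to X$ and $!\colon\varnothing\to X$, and $\delta_X$, $\epsilon_X$ the opposite (reflected) cospans of these with empty decoration. *)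

(* Defs.v *)
From HB Require Import structures.
From mathcomp Require Import ssreflect ssrfun ssrbool eqtype choice fintype.
From mathcomp Require Import generic_quotient.
From mathcomp Require Import boolp classical_sets cardinality.

Set Implicit Arguments.
Unset Strict Implicit.
Unset Printing Implicit Defensive.

Declare Scope cat_scope.
Local Open Scope classical_set_scope.
Local Open Scope quotient_scope.
Local Open Scope cat_scope.

Record Category := MkCategory {
  Obj :> Type;
  Hom : Obj -> Obj -> Type;
  idm : forall X, Hom X X;
  compose : forall X Y Z, Hom Y Z -> Hom X Y -> Hom X Z;
  comp_idl : forall X Y (f : Hom X Y), compose (idm Y) f = f;
  comp_idr : forall X Y (f : Hom X Y), compose f (idm X) = f;
  comp_assoc : forall X Y Z W (h : Hom Z W) (g : Hom Y Z) (f : Hom X Y),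
    compose (compose h g) f = compose h (compose g f)
}.
Arguments Hom {c} X Y.
Arguments idm {c} X.
Arguments compose {c X Y Z} g f.

Notation "g ∘ f" := (compose g f)
  (at level 40, left associativity) : cat_scope.

Record Iso (C : Category) (X Y : C) := MkIso {
  fwd :> Hom X Y;
  bwd : Hom Y X;
  fwdK : bwd ∘ fwd = idm X;
  bwdK : fwd ∘ bwd = idm Y
}.

Definition hom_cast (C : Category) (X X' Y Y' : C) (eX : X = X') (eY : Y = Y')
    (f : Hom X Y) : Hom X' Y' :=
  ecast Z (Hom X' Z) eY (ecast Z (Hom Z Y) eX f).

Record Functor (C D : Category) := MkFunctor {
  fobj :> C -> D;
  fmap : forall X Y, Hom X Y -> Hom (fobj X) (fobj Y);
  fmap_id : forall X, fmap (idm X) = idm (fobj X);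
  fmap_comp : forall X Y Z (g : Hom Y Z) (f : Hom X Y),
    fmap (g ∘ f) = fmap g ∘ fmap f
}.
Arguments fmap {C D} F {X Y} f : rename.

Section FunctorComp.
Variables (C D E : Category) (G : Functor D E) (F : Functor C D).
Lemma functor_comp_id X : fmap G (fmap F (idm X)) = idm (G (F X)).
Proof. by rewrite !fmap_id. Qed.
Lemma functor_comp_comp X Y Z (g : Hom Y Z) (f : Hom X Y) :
  fmap G (fmap F (g ∘ f)) = fmap G (fmap F g) ∘ fmap G (fmap F f).
Proof. by rewrite !fmap_comp. Qed.
Definition functor_comp : Functor C E :=
  @MkFunctor C E (fun X => G (F X)) (fun X Y f => fmap G (fmap F f))
    functor_comp_id functor_comp_comp.
End FunctorComp.

Record Cocone (J C : Category) (D : Functor J C) := MkCocone {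
  apex :> C;
  leg : forall j, Hom (D j) apex;
  leg_comp : forall j k (f : Hom j k), leg k ∘ fmap D f = leg j
}.
Arguments leg {J C D} c j.

Definition is_colimit (J C : Category) (D : Functor J C) (c : Cocone D) : Prop :=
  forall c' : Cocone D,
    exists! h : Hom (apex c) (apex c'), forall j, h ∘ leg c j = leg c' j.

Section FunctorCocone.
Variables (J C C' : Category) (A : Functor C C') (D : Functor J C).
Variable c : Cocone D.
Lemma map_cocone_comp j k (f : Hom j k) :
  fmap A (leg c k) ∘ fmap (functor_comp A D) f = fmap A (leg c j).
Proof. by rewrite /= -fmap_comp leg_comp. Qed.
Definition map_cocone : Cocone (functor_comp A D) :=
  MkCocone map_cocone_comp.
End FunctorCocone.

Record FinCategory := MkFinCategory {
  fincat :> Category;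
  finite_obj : finite_set [set: Obj fincat];
  finite_hom : forall X Y : fincat, finite_set [set: Hom X Y]
}.

(* A category with finite colimits, together with a choice of them. *)
Record FinCocompleteCategory := MkFinCocomplete {
  fccat :> Category;
  colim : forall (J : FinCategory) (D : Functor J fccat), Cocone D;
  colimP : forall (J : FinCategory) (D : Functor J fccat), is_colimit (colim D)
}.
Arguments colimP {f J} D c'.

Definition preserves_finite_colimits (C C' : Category) (A : Functor C C') :=
  forall (J : FinCategory) (D : Functor J C) (c : Cocone D),
    is_colimit c -> is_colimit (map_cocone A c).

Section Thin.
Variables (T : finType) (le : rel T).
Hypotheses (le_refl : reflexive le) (le_trans : transitive le).
Definition thin : Category.
Proof.
refine (@MkCategory T (fun x y => is_true (le x y)) le_refl
  (fun x y z g f => le_trans f g) _ _ _) => *; exact: bool_irrelevance.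
Defined.
Lemma thin_finite_obj : finite_set [set: Obj thin].
Proof. exact: (@finite_finset T). Qed.
Lemma thin_finite_hom (X Y : thin) : finite_set [set: Hom X Y].
Proof.
have [h|nh] := boolP (le X Y).
  have -> : [set: Hom X Y] = [set h].
    by apply/seteqP; split => // h' _; exact: bool_irrelevance.
  exact: finite_set1.
have -> : [set: Hom X Y] = set0 by apply/seteqP; split => // h; case: (negP nh).
exact: finite_set0.
Qed.
Definition thin_fin : FinCategory := MkFinCategory thin_finite_obj thin_finite_hom.
End Thin.

Definition empty_le : rel void := fun _ _ => true.
Lemma empty_refl : reflexive empty_le. Proof. by []. Qed.
Lemma empty_trans : transitive empty_le. Proof. by []. Qed.
Definition EmptyCat := thin_fin empty_refl empty_trans.

Definition two_le : rel bool := eq_op.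
Lemma two_refl : reflexive two_le. Proof. exact: eqxx. Qed.
Lemma two_trans : transitive two_le. Proof. exact: eq_op_trans. Qed.
Definition TwoCat := thin_fin two_refl two_trans.

(* The shape [Some true <- None -> Some false]. *)
Definition span_le : rel (option bool) := fun x y => (x == y) || (x == None).
Lemma span_refl : reflexive span_le. Proof. by case=> [[]|]. Qed.
Lemma span_trans : transitive span_le.
Proof. by case=> [[]|] [[]|] [[]|]. Qed.
Definition SpanCat := thin_fin span_refl span_trans.

Section Diagrams.
Variable C : Category.

Definition empty_diagram : Functor EmptyCat C.
Proof.
refine (@MkFunctor EmptyCat C (fun v : void => match v with end)
  (fun v : void => match v with end) _ _); by case.
Defined.

Section Two.
Variables X Y : C.
Definition two_obj (b : bool) : C := if b then X else Y.
Definition two_map (b b' : bool) : two_le b b' -> Hom (two_obj b) (two_obj b') :=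
  match b, b' with
  | true, true => fun _ => idm X
  | false, false => fun _ => idm Y
  | true, false | false, true => fun h => False_rect _ (notF h)
  end.
Definition two_diagram : Functor TwoCat C.
Proof.
refine (@MkFunctor TwoCat C two_obj two_map _ _); first by case.
by case=> [] [] [] // g f; rewrite /= comp_idl.
Defined.
End Two.

Section Span.
Variables (Z X Y : C) (f : Hom Z X) (g : Hom Z Y).
Definition span_obj (x : option bool) : C :=
  match x with None => Z | Some true => X | Some false => Y end.
Definition span_map (x y : option bool) :
    span_le x y -> Hom (span_obj x) (span_obj y) :=
  match x, y with
  | None, None => fun _ => idm Z
  | None, Some true => fun _ => f
  | None, Some false => fun _ => g
  | Some true, Some true => fun _ => idm X
  | Some false, Some false => fun _ => idm Y
  | Some true, Some false | Some true, None
  | Some false, Some true | Some false, None => fun h => False_rect _ (notF h)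
  end.
Definition span_diagram : Functor SpanCat C.
Proof.
refine (@MkFunctor SpanCat C span_obj span_map _ _); first by case=> [[]|].
by case=> [[]|] [[]|] [[]|] // k h; rewrite /= ?comp_idl ?comp_idr.
Defined.
End Span.

Definition empty_cocone (X : C) : Cocone empty_diagram.
Proof.
refine (@MkCocone _ _ empty_diagram X (fun v : void => match v with end) _); by case.
Defined.

Definition two_cocone (X Y Z : C) (f : Hom X Z) (g : Hom Y Z) :
  Cocone (two_diagram X Y).
Proof.
refine (@MkCocone _ _ (two_diagram X Y) Z
  (fun b => match b with true => f | false => g end) _).
by case=> [] [] // h; rewrite /= comp_idr.
Defined.

Definition span_cocone (Z X Y W : C) (f : Hom Z X) (g : Hom Z Y)
    (p : Hom X W) (q : Hom Y W) (e : p ∘ f = q ∘ g) : Cocone (span_diagram f g).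
Proof.
refine (@MkCocone _ _ (span_diagram f g) W
  (fun x => match x with None => p ∘ f | Some true => p | Some false => q end) _).
by case=> [[]|] [[]|] // h; rewrite /= ?comp_idr.
Defined.
End Diagrams.

Section FiniteColimits.
Variable C : FinCocompleteCategory.

Definition initial : C := colim (empty_diagram C).
Lemma bang_subproof (X : C) : exists! f : Hom initial X, True.
Proof.
have [h [_ hu]] := colimP _ (empty_cocone X).
by exists h; split => // h' _; apply: hu; case.
Qed.
Definition bang (X : C) : Hom initial X := projT1 (cid (bang_subproof X)).
Lemma initial_ext (X : C) (f g : Hom initial X) : f = g.
Proof. by have [h [_ hu]] := bang_subproof X; rewrite -(hu f) // -(hu g). Qed.

Definition coprod (X Y : C) : C := colim (two_diagram X Y).
Definition inl (X Y : C) : Hom X (coprod X Y) := leg (colim (two_diagram X Y)) true.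
Definition inr (X Y : C) : Hom Y (coprod X Y) := leg (colim (two_diagram X Y)) false.
Lemma copair_subproof (X Y Z : C) (f : Hom X Z) (g : Hom Y Z) :
  exists! h : Hom (coprod X Y) Z, h ∘ inl X Y = f /\ h ∘ inr X Y = g.
Proof.
have [h [hE hu]] := colimP _ (two_cocone f g).
exists h; split; first by split; [exact: (hE true)|exact: (hE false)].
by move=> h' [h1 h2]; apply: hu; case.
Qed.
Definition copair (X Y Z : C) (f : Hom X Z) (g : Hom Y Z) : Hom (coprod X Y) Z :=
  projT1 (cid (copair_subproof f g)).
Lemma copair_inl (X Y Z : C) (f : Hom X Z) (g : Hom Y Z) :
  copair f g ∘ inl X Y = f.
Proof. by rewrite /copair; case: cid => h /= [[]]. Qed.
Lemma copair_inr (X Y Z : C) (f : Hom X Z) (g : Hom Y Z) :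
  copair f g ∘ inr X Y = g.
Proof. by rewrite /copair; case: cid => h /= [[]]. Qed.
Lemma coprod_ext (X Y Z : C) (f g : Hom (coprod X Y) Z) :
  f ∘ inl X Y = g ∘ inl X Y -> f ∘ inr X Y = g ∘ inr X Y -> f = g.
Proof.
move=> e1 e2.
have [h [_ hu]] := copair_subproof (g ∘ inl X Y) (g ∘ inr X Y).
by rewrite -(hu f) // -(hu g).
Qed.

Section Pushout.
Variables (Z X Y : C) (f : Hom Z X) (g : Hom Z Y).
Definition pushout : C := colim (span_diagram f g).
Definition po1 : Hom X pushout := leg (colim (span_diagram f g)) (Some true).
Definition po2 : Hom Y pushout := leg (colim (span_diagram f g)) (Some false).
End Pushout.

Definition is_pushout (Z X Y W : C) (f : Hom Z X) (g : Hom Z Y)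
    (p : Hom X W) (q : Hom Y W) : Prop :=
  p ∘ f = q ∘ g /\
  forall (V : C) (p' : Hom X V) (q' : Hom Y V), p' ∘ f = q' ∘ g ->
    exists! h : Hom W V, h ∘ p = p' /\ h ∘ q = q'.

Lemma pushoutP (Z X Y : C) (f : Hom Z X) (g : Hom Z Y) :
  is_pushout f g (po1 f g) (po2 f g).
Proof.
split.
  transitivity (leg (colim (span_diagram f g)) None).
    exact: (@leg_comp _ _ _ (colim (span_diagram f g)) None (Some true) isT).
  symmetry; exact: (@leg_comp _ _ _ (colim (span_diagram f g)) None (Some false) isT).
move=> V p' q' e; have [h [hE hu]] := colimP _ (span_cocone e).
exists h; split; first by split; [exact: (hE (Some true))|exact: (hE (Some false))].
move=> h' [h1 h2]; apply: hu; case=> [[]|] //=.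
by rewrite -(@leg_comp _ _ _ (colim (span_diagram f g)) None (Some true) isT) /=
  -comp_assoc -h1.
Qed.
End FiniteColimits.
Arguments inl {C} X Y.
Arguments inr {C} X Y.
Arguments initial : clear implicits.

(* The redundant axioms [lunit_unit] here and [braid_unit] below are those of
   Mac Lane's presentation. *)
Record MonoidalCategory := MkMonoidal {
  mcat :> Category;
  unit : mcat;
  tensor : mcat -> mcat -> mcat;
  tensorm : forall X X' Y Y' : mcat,
    Hom X X' -> Hom Y Y' -> Hom (tensor X Y) (tensor X' Y');
  tensorm_id : forall X Y, tensorm (idm X) (idm Y) = idm (tensor X Y);
  tensorm_comp : forall X X' X'' Y Y' Y''
    (f' : Hom X' X'') (f : Hom X X') (g' : Hom Y' Y'') (g : Hom Y Y'),
    tensorm (f' ∘ f) (g' ∘ g) = tensorm f' g' ∘ tensorm f g;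
  assoc : forall X Y Z, Iso (tensor (tensor X Y) Z) (tensor X (tensor Y Z));
  lunit : forall X, Iso (tensor unit X) X;
  runit : forall X, Iso (tensor X unit) X;
  assoc_nat : forall X X' Y Y' Z Z' (f : Hom X X') (g : Hom Y Y') (h : Hom Z Z'),
    assoc X' Y' Z' ∘ tensorm (tensorm f g) h =
    tensorm f (tensorm g h) ∘ assoc X Y Z;
  lunit_nat : forall X X' (f : Hom X X'),
    lunit X' ∘ tensorm (idm unit) f = f ∘ lunit X;
  runit_nat : forall X X' (f : Hom X X'),
    runit X' ∘ tensorm f (idm unit) = f ∘ runit X;
  triangle : forall X Y,
    tensorm (idm X) (lunit Y) ∘ assoc X unit Y = tensorm (runit X) (idm Y);
  pentagon : forall X Y Z W,
    tensorm (idm X) (assoc Y Z W) ∘ assoc X (tensor Y Z) W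
      ∘ tensorm (assoc X Y Z) (idm W) =
    assoc X Y (tensor Z W) ∘ assoc (tensor X Y) Z W;
  lunit_unit : lunit unit = runit unit :> Hom (tensor unit unit) unit
}.
Arguments unit : clear implicits.
Arguments tensor {m} X Y.
Arguments tensorm {m X X' Y Y'} f g.
Arguments assoc {m} X Y Z.
Arguments lunit {m} X.
Arguments runit {m} X.
Notation "X ⊗ Y" := (tensor X Y) (at level 35, right associativity) : cat_scope.
Notation "f ⊠ g" := (tensorm f g) (at level 35, right associativity) : cat_scope.

Record BraidedCategory := MkBraided {
  bmon :> MonoidalCategory;
  braid : forall X Y : bmon, Iso (X ⊗ Y) (Y ⊗ X);
  braid_nat : forall X X' Y Y' (f : Hom X X') (g : Hom Y Y'),
    braid X' Y' ∘ (f ⊠ g) = (g ⊠ f) ∘ braid X Y;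
  braid_unit : forall X,
    lunit X ∘ braid X (unit bmon) = runit X;
  hexagon1 : forall X Y Z,
    assoc Y Z X ∘ braid X (Y ⊗ Z) ∘ assoc X Y Z =
    (idm Y ⊠ braid X Z) ∘ assoc Y X Z ∘ (braid X Y ⊠ idm Z);
  hexagon2 : forall X Y Z,
    bwd (assoc Z X Y) ∘ braid (X ⊗ Y) Z ∘ bwd (assoc X Y Z) =
    (braid X Z ⊠ idm Y) ∘ bwd (assoc X Z Y) ∘ (idm X ⊠ braid Y Z)
}.
Arguments braid {b} X Y.

Record SymmetricCategory := MkSymmetric {
  sbraid :> BraidedCategory;
  braidK : forall X Y : sbraid, braid Y X ∘ braid X Y = idm (X ⊗ Y)
}.

(* [(X ⊗ Y) ⊗ (Z ⊗ W) -> (X ⊗ Z) ⊗ (Y ⊗ W)], that is [1 ⊗ σ ⊗ 1] with the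
   associators made explicit. *)
Definition mid_swap (S : BraidedCategory) (X Y Z W : S) :
    Hom ((X ⊗ Y) ⊗ (Z ⊗ W)) ((X ⊗ Z) ⊗ (Y ⊗ W)) :=
  bwd (assoc X Z (Y ⊗ W)) ∘ (idm X ⊠ assoc Z Y W)
    ∘ (idm X ⊠ (braid Y Z ⊠ idm W))
    ∘ (idm X ⊠ bwd (assoc Y Z W)) ∘ assoc X Y (Z ⊗ W).

Record SpecialCommFrobenius (S : SymmetricCategory) (X : S) := MkFrobenius {
  mu : Hom (X ⊗ X) X;
  eta : Hom (unit S) X;
  delta : Hom X (X ⊗ X);
  epsilon : Hom X (unit S);
  mu_assoc : mu ∘ (mu ⊠ idm X) = mu ∘ (idm X ⊠ mu) ∘ assoc X X X;
  mu_unitl : mu ∘ (eta ⊠ idm X) = lunit X;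
  mu_unitr : mu ∘ (idm X ⊠ eta) = runit X;
  mu_comm : mu ∘ braid X X = mu;
  delta_assoc : assoc X X X ∘ (delta ⊠ idm X) ∘ delta = (idm X ⊠ delta) ∘ delta;
  delta_unitl : lunit X ∘ (epsilon ⊠ idm X) ∘ delta = idm X;
  delta_unitr : runit X ∘ (idm X ⊠ epsilon) ∘ delta = idm X;
  delta_comm : braid X X ∘ delta = delta;
  frobenius_l : (idm X ⊠ mu) ∘ assoc X X X ∘ (delta ⊠ idm X) = delta ∘ mu;
  frobenius_r : (mu ⊠ idm X) ∘ bwd (assoc X X X) ∘ (idm X ⊠ delta) = delta ∘ mu;
  frobenius_special : mu ∘ delta = idm X
}.

Record HypergraphCategory := MkHypergraph {
  hsym :> SymmetricCategory;
  frob : forall X : hsym, SpecialCommFrobenius X;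
  mu_tensor : forall X Y,
    mu (frob (X ⊗ Y)) = (mu (frob X) ⊠ mu (frob Y)) ∘ mid_swap X Y X Y;
  eta_tensor : forall X Y,
    eta (frob (X ⊗ Y)) = (eta (frob X) ⊠ eta (frob Y)) ∘ bwd (lunit (unit hsym));
  delta_tensor : forall X Y,
    delta (frob (X ⊗ Y)) = mid_swap X X Y Y ∘ (delta (frob X) ⊠ delta (frob Y));
  epsilon_tensor : forall X Y,
    epsilon (frob (X ⊗ Y)) =
    lunit (unit hsym) ∘ (epsilon (frob X) ⊠ epsilon (frob Y))
}.
Arguments frob {h} X.

Record LaxMonoidalFunctor (M N : MonoidalCategory) := MkLax {
  lfun :> Functor M N;
  lax_mu : forall X Y, Hom (lfun X ⊗ lfun Y) (lfun (X ⊗ Y));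
  lax_unit : Hom (unit N) (lfun (unit M));
  lax_mu_nat : forall X X' Y Y' (f : Hom X X') (g : Hom Y Y'),
    lax_mu X' Y' ∘ (fmap lfun f ⊠ fmap lfun g) = fmap lfun (f ⊠ g) ∘ lax_mu X Y;
  lax_assoc : forall X Y Z,
    fmap lfun (assoc X Y Z) ∘ lax_mu (X ⊗ Y) Z ∘ (lax_mu X Y ⊠ idm (lfun Z)) =
    lax_mu X (Y ⊗ Z) ∘ (idm (lfun X) ⊠ lax_mu Y Z)
      ∘ assoc (lfun X) (lfun Y) (lfun Z);
  lax_unitl : forall X,
    fmap lfun (lunit X) ∘ lax_mu (unit M) X ∘ (lax_unit ⊠ idm (lfun X)) =
    lunit (lfun X);
  lax_unitr : forall X,
    fmap lfun (runit X) ∘ lax_mu X (unit M) ∘ (idm (lfun X) ⊠ lax_unit) =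
    runit (lfun X)
}.
Arguments lax_mu {M N} l X Y.
Arguments lax_unit {M N} l.

Section LaxComp.
Variables (M N P : MonoidalCategory).
Variables (G : LaxMonoidalFunctor N P) (F : LaxMonoidalFunctor M N).
Let H := functor_comp G F.
Definition lax_comp_mu (X Y : M) : Hom (H X ⊗ H Y) (H (X ⊗ Y)) :=
  fmap G (lax_mu F X Y) ∘ lax_mu G (F X) (F Y).
Definition lax_comp_unit : Hom (unit P) (H (unit M)) :=
  fmap G (lax_unit F) ∘ lax_unit G.
Lemma lax_comp_nat X X' Y Y' (f : Hom X X') (g : Hom Y Y') :
  lax_comp_mu X' Y' ∘ (fmap H f ⊠ fmap H g) = fmap H (f ⊠ g) ∘ lax_comp_mu X Y.
Proof.
by rewrite /lax_comp_mu comp_assoc /= lax_mu_nat -!comp_assoc -!fmap_comp lax_mu_nat.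
Qed.
Lemma tensorm_compl (X X' X'' Y : P) (f : Hom X' X'') (g : Hom X X') :
  (f ∘ g) ⊠ idm Y = (f ⊠ idm Y) ∘ (g ⊠ idm Y).
Proof. by rewrite -tensorm_comp comp_idl. Qed.
Lemma tensorm_compr (X X' X'' Y : P) (f : Hom X' X'') (g : Hom X X') :
  idm Y ⊠ (f ∘ g) = (idm Y ⊠ f) ∘ (idm Y ⊠ g).
Proof. by rewrite -tensorm_comp comp_idl. Qed.
Lemma lax_comp_assoc X Y Z :
  fmap H (assoc X Y Z) ∘ lax_comp_mu (X ⊗ Y) Z ∘ (lax_comp_mu X Y ⊠ idm (H Z)) =
  lax_comp_mu X (Y ⊗ Z) ∘ (idm (H X) ⊠ lax_comp_mu Y Z) ∘ assoc (H X) (H Y) (H Z).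
Proof.
rewrite /lax_comp_mu tensorm_compl tensorm_compr /= -(fmap_id G (F Z))
  -(fmap_id G (F X)) !comp_assoc.
rewrite -[lax_mu G _ _ ∘ (_ ∘ (_ ∘ assoc _ _ _))]comp_assoc lax_mu_nat.
rewrite -[lax_mu G _ _ ∘ (_ ∘ _)]comp_assoc lax_mu_nat.
rewrite !fmap_id !comp_assoc -[lax_mu G _ _ ∘ (_ ∘ assoc _ _ _)]comp_assoc.
by rewrite -lax_assoc -!comp_assoc -!fmap_comp lax_assoc.
Qed.
Lemma lax_comp_unitl X :
  fmap H (lunit X) ∘ lax_comp_mu (unit M) X ∘ (lax_comp_unit ⊠ idm (H X)) =
  lunit (H X).
Proof.
rewrite /lax_comp_mu /lax_comp_unit tensorm_compl /= -(fmap_id G (F X)) !comp_assoc.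
rewrite -[lax_mu G _ _ ∘ (_ ∘ _)]comp_assoc lax_mu_nat -!comp_assoc -!fmap_comp.
by rewrite lax_unitl fmap_id lax_unitl.
Qed.
Lemma lax_comp_unitr X :
  fmap H (runit X) ∘ lax_comp_mu X (unit M) ∘ (idm (H X) ⊠ lax_comp_unit) =
  runit (H X).
Proof.
rewrite /lax_comp_mu /lax_comp_unit tensorm_compr /= -(fmap_id G (F X)) !comp_assoc.
rewrite -[lax_mu G _ _ ∘ (_ ∘ _)]comp_assoc lax_mu_nat -!comp_assoc -!fmap_comp.
by rewrite lax_unitr fmap_id lax_unitr.
Qed.
Definition lax_comp : LaxMonoidalFunctor M P :=
  MkLax lax_comp_nat lax_comp_assoc lax_comp_unitl lax_comp_unitr.
End LaxComp.

Record LaxBraidedFunctor (M N : BraidedCategory) := MkLaxBraided {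
  lbfun :> LaxMonoidalFunctor M N;
  lax_braid : forall X Y,
    fmap lbfun (braid X Y) ∘ lax_mu lbfun X Y =
    lax_mu lbfun Y X ∘ braid (lbfun X) (lbfun Y)
}.

(* A symmetric monoidal functor is a braided monoidal functor between symmetric
   monoidal categories; strength is recorded by inverses of the coherence maps. *)
Record StrongSymmetricFunctor (M N : SymmetricCategory) := MkStrong {
  ssfun :> LaxBraidedFunctor M N;
  mu_inv : forall X Y, Hom (ssfun (X ⊗ Y)) (ssfun X ⊗ ssfun Y);
  unit_inv : Hom (ssfun (unit M)) (unit N);
  lax_muK : forall X Y, mu_inv X Y ∘ lax_mu ssfun X Y = idm (ssfun X ⊗ ssfun Y);
  mu_invK : forall X Y, lax_mu ssfun X Y ∘ mu_inv X Y = idm (ssfun (X ⊗ Y));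
  lax_unitK : unit_inv ∘ lax_unit ssfun = idm (unit N);
  unit_invK : lax_unit ssfun ∘ unit_inv = idm (ssfun (unit M))
}.
Arguments mu_inv {M N} s X Y.
Arguments unit_inv {M N} s.

Record HypergraphFunctor (M N : HypergraphCategory) := MkHypergraphFunctor {
  hfun :> StrongSymmetricFunctor M N;
  hfun_mu : forall X : M,
    mu (frob (hfun X)) = fmap hfun (mu (frob X)) ∘ lax_mu hfun X X;
  hfun_delta : forall X : M,
    delta (frob (hfun X)) = mu_inv hfun X X ∘ fmap hfun (delta (frob X));
  hfun_eta : forall X : M,
    eta (frob (hfun X)) = fmap hfun (eta (frob X)) ∘ lax_unit hfun;
  hfun_epsilon : forall X : M,
    epsilon (frob (hfun X)) = unit_inv hfun ∘ fmap hfun (epsilon (frob X))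
}.

(* The coherence maps are identities; as source and target are a priori
   different objects, this includes their equality. *)
Definition is_strict (M N : MonoidalCategory) (H : LaxMonoidalFunctor M N) : Prop :=
  (forall X Y, exists e : H X ⊗ H Y = H (X ⊗ Y),
     lax_mu H X Y = hom_cast erefl e (idm (H X ⊗ H Y))) /\
  (exists e : unit N = H (unit M),
     lax_unit H = hom_cast erefl e (idm (unit N))).

Record MonoidalTransformation (M N : MonoidalCategory)
    (P Q : LaxMonoidalFunctor M N) := MkMonoidalTransformation {
  component :> forall X, Hom (P X) (Q X);
  component_nat : forall X Y (f : Hom X Y),
    component Y ∘ fmap P f = fmap Q f ∘ component X;
  component_mu : forall X Y,
    component (X ⊗ Y) ∘ lax_mu P X Y =
    lax_mu Q X Y ∘ (component X ⊠ component Y);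
  component_unit : component (unit M) ∘ lax_unit P = lax_unit Q
}.

Section CoproductMonoidal.
Variable C : FinCocompleteCategory.

Lemma comp_copair (X Y Z W : C) (h : Hom Z W) (f : Hom X Z) (g : Hom Y Z) :
  h ∘ copair f g = copair (h ∘ f) (h ∘ g).
Proof.
by apply: coprod_ext; rewrite comp_assoc ?copair_inl ?copair_inr.
Qed.
Lemma comp_copairA (X Y Z W V : C) (h : Hom Z W) (f : Hom X Z) (g : Hom Y Z)
    (k : Hom V (coprod X Y)) :
  h ∘ (copair f g ∘ k) = copair (h ∘ f) (h ∘ g) ∘ k.
Proof. by rewrite -comp_assoc comp_copair. Qed.
Lemma copair_inlA (X Y Z W : C) (f : Hom X Z) (g : Hom Y Z) (h : Hom W X) :
  copair f g ∘ (inl X Y ∘ h) = f ∘ h.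
Proof. by rewrite -comp_assoc copair_inl. Qed.
Lemma copair_inrA (X Y Z W : C) (f : Hom X Z) (g : Hom Y Z) (h : Hom W Y) :
  copair f g ∘ (inr X Y ∘ h) = g ∘ h.
Proof. by rewrite -comp_assoc copair_inr. Qed.
Lemma copair_id (X Y : C) : copair (inl X Y) (inr X Y) = idm (coprod X Y).
Proof. by apply: coprod_ext; rewrite ?copair_inl ?copair_inr comp_idl. Qed.

Definition coprodm (X X' Y Y' : C) (f : Hom X X') (g : Hom Y Y') :
    Hom (coprod X Y) (coprod X' Y') :=
  copair (inl X' Y' ∘ f) (inr X' Y' ∘ g).
Definition coassoc_fwd (X Y Z : C) :
    Hom (coprod (coprod X Y) Z) (coprod X (coprod Y Z)) :=
  copair (copair (inl X (coprod Y Z)) (inr X (coprod Y Z) ∘ inl Y Z))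
    (inr X (coprod Y Z) ∘ inr Y Z).
Definition coassoc_bwd (X Y Z : C) :
    Hom (coprod X (coprod Y Z)) (coprod (coprod X Y) Z) :=
  copair (inl (coprod X Y) Z ∘ inl X Y)
    (copair (inl (coprod X Y) Z ∘ inr X Y) (inr (coprod X Y) Z)).
Definition colunit_fwd (X : C) : Hom (coprod (initial C) X) X :=
  copair (bang X) (idm X).
Definition corunit_fwd (X : C) : Hom (coprod X (initial C)) X :=
  copair (idm X) (bang X).
Definition cobraid_fwd (X Y : C) : Hom (coprod X Y) (coprod Y X) :=
  copair (inr Y X) (inl Y X).

Definition coprodE := (comp_assoc, comp_idl, comp_idr, copair_inl, copair_inr,
  copair_inlA, copair_inrA, comp_copairA, comp_copair, copair_id).

End CoproductMonoidal.

Ltac coprod_eq :=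
  rewrite /= /coprodm /coassoc_fwd /coassoc_bwd /colunit_fwd /corunit_fwd
    /cobraid_fwd;
  repeat (first [ apply: initial_ext | apply: coprod_ext ]);
  rewrite ?coprodE //=; try apply: initial_ext.

Section CoproductMonoidal.
Variable C : FinCocompleteCategory.

Lemma coassocK (X Y Z : C) : coassoc_bwd X Y Z ∘ coassoc_fwd X Y Z = idm _.
Proof. by coprod_eq. Qed.
Lemma coassocVK (X Y Z : C) : coassoc_fwd X Y Z ∘ coassoc_bwd X Y Z = idm _.
Proof. by coprod_eq. Qed.
Definition coassoc (X Y Z : C) := MkIso (coassocK X Y Z) (coassocVK X Y Z).
Lemma colunitK (X : C) : inr (initial C) X ∘ colunit_fwd X = idm _.
Proof. by coprod_eq. Qed.
Lemma colunitVK (X : C) : colunit_fwd X ∘ inr (initial C) X = idm X.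
Proof. by coprod_eq. Qed.
Definition colunit (X : C) := MkIso (colunitK X) (colunitVK X).
Lemma corunitK (X : C) : inl X (initial C) ∘ corunit_fwd X = idm _.
Proof. by coprod_eq. Qed.
Lemma corunitVK (X : C) : corunit_fwd X ∘ inl X (initial C) = idm X.
Proof. by coprod_eq. Qed.
Definition corunit (X : C) := MkIso (corunitK X) (corunitVK X).
Lemma cobraidK (X Y : C) : cobraid_fwd Y X ∘ cobraid_fwd X Y = idm _.
Proof. by coprod_eq. Qed.
Definition cobraid (X Y : C) := MkIso (cobraidK X Y) (cobraidK Y X).

Definition coproduct_monoidal : MonoidalCategory.
Proof.
refine (@MkMonoidal C (initial C) (@coprod C) (@coprodm C) _ _
  coassoc colunit corunit _ _ _ _ _ _) => *; by coprod_eq.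
Defined.

Definition coproduct_braided : BraidedCategory.
Proof.
refine (@MkBraided coproduct_monoidal cobraid _ _ _ _) => *; by coprod_eq.
Defined.

Definition coproduct : SymmetricCategory :=
  @MkSymmetric coproduct_braided (fun X Y => cobraidK X Y).
End CoproductMonoidal.

Section CoproductFunctor.
Variables (C C' : FinCocompleteCategory) (A : Functor C C').
Hypothesis hA : preserves_finite_colimits A.

Definition alpha (X Y : C) : Hom (coprod (A X) (A Y)) (A (coprod X Y)) :=
  copair (fmap A (inl X Y)) (fmap A (inr X Y)).
Definition alpha_unit : Hom (initial C') (A (initial C)) := bang (A (initial C)).

Lemma A_initial (Z : C') : exists! h : Hom (A (initial C)) Z, True.
Proof.
pose c := @MkCocone EmptyCat C' (functor_comp A (empty_diagram C)) Z
  (fun v : void => match v with end) (fun v : void => match v with end).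
have [h [_ hu]] := hA (colimP (empty_diagram C)) c.
by exists h; split => // h' _; apply: hu; case.
Qed.
Lemma A_coprod (X Y : C) (Z : C') (f : Hom (A X) Z) (g : Hom (A Y) Z) :
  exists! h : Hom (A (coprod X Y)) Z,
    h ∘ fmap A (inl X Y) = f /\ h ∘ fmap A (inr X Y) = g.
Proof.
pose l (b : bool) : Hom (functor_comp A (two_diagram X Y) b) Z :=
  match b with true => f | false => g end.
have lE j k (e : @Hom TwoCat j k) :
  l k ∘ fmap (functor_comp A (two_diagram X Y)) e = l j.
  by case: j k e => [] [] // e; rewrite /= fmap_id comp_idr.
have [h [hE hu]] := hA (colimP (two_diagram X Y)) (MkCocone lE).
exists h; split; first by split; [exact: (hE true)|exact: (hE false)].
by move=> h' [h1 h2]; apply: hu; case.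
Qed.

Definition alpha_inv (X Y : C) : Hom (A (coprod X Y)) (coprod (A X) (A Y)) :=
  projT1 (cid (A_coprod (inl (A X) (A Y)) (inr (A X) (A Y)))).
Definition alpha_unit_inv : Hom (A (initial C)) (initial C') :=
  projT1 (cid (A_initial (initial C'))).

Lemma alphaK (X Y : C) : alpha_inv X Y ∘ alpha X Y = idm (coprod (A X) (A Y)).
Proof.
rewrite /alpha_inv; case: cid => h /= [[h1 h2] _].
by apply: coprod_ext; rewrite comp_assoc ?copair_inl ?copair_inr ?comp_idl.
Qed.
Lemma alpha_invK (X Y : C) : alpha X Y ∘ alpha_inv X Y = idm (A (coprod X Y)).
Proof.
rewrite /alpha_inv; case: cid => h /= [[h1 h2] _].
have [k [_ ku]] := A_coprod (fmap A (inl X Y)) (fmap A (inr X Y)).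
rewrite -[RHS](ku (idm _)) ?comp_idl //.
by apply/esym/ku; rewrite !comp_assoc h1 h2 copair_inl copair_inr.
Qed.
Lemma alpha_unitK : alpha_unit_inv ∘ alpha_unit = idm (initial C').
Proof. exact: initial_ext. Qed.
Lemma alpha_unit_invK : alpha_unit ∘ alpha_unit_inv = idm (A (initial C)).
Proof.
have [k [_ ku]] := A_initial (A (initial C)).
by rewrite -(ku (idm _)) // -(ku (alpha_unit ∘ alpha_unit_inv)).
Qed.

Definition coproduct_functor_lax :
  LaxMonoidalFunctor (coproduct C) (coproduct C').
Proof.
refine (@MkLax (coproduct C) (coproduct C') A alpha alpha_unit _ _ _ _) => *;
  rewrite /alpha /alpha_unit; coprod_eq; rewrite -?fmap_comp ?coprodE ?fmap_id //.
Defined.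

Definition coproduct_functor_braided :
  LaxBraidedFunctor (coproduct C) (coproduct C').
Proof.
refine (@MkLaxBraided (coproduct C) (coproduct C') coproduct_functor_lax _) => *.
rewrite /= /alpha; coprod_eq; by rewrite -?fmap_comp ?coprodE.
Defined.

(* [(A, α)]: the comparison [α] is determined by [A], and invertible because [A]
   preserves finite colimits. *)
Definition coproduct_functor :
    StrongSymmetricFunctor (coproduct C) (coproduct C') :=
  @MkStrong (coproduct C) (coproduct C') coproduct_functor_braided
    alpha_inv alpha_unit_inv alphaK alpha_invK alpha_unitK alpha_unit_invK.
End CoproductFunctor.

Section DecoratedCospan.
Variables (C : FinCocompleteCategory) (D : BraidedCategory).
Variable F : LaxBraidedFunctor (coproduct C) D.
Implicit Types X Y Z N M : C.

Record DecoratedCospan X Y := MkCospan {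
  cospan_apex : C;
  cospan_in : Hom X cospan_apex;
  cospan_out : Hom Y cospan_apex;
  decoration : Hom (unit D) (F cospan_apex)
}.
Arguments MkCospan {X Y cospan_apex} _ _ _.

Definition is_cospan_map X Y (c d : DecoratedCospan X Y)
    (n : Hom (cospan_apex c) (cospan_apex d)) : Prop :=
  [/\ n ∘ cospan_in c = cospan_in d,
      n ∘ cospan_out c = cospan_out d &
      fmap F n ∘ decoration c = decoration d].

Definition cospan_iso X Y (c d : DecoratedCospan X Y) : Prop :=
  exists n : Hom (cospan_apex c) (cospan_apex d),
  exists m : Hom (cospan_apex d) (cospan_apex c),
    [/\ is_cospan_map n, is_cospan_map m, m ∘ n = idm _ & n ∘ m = idm _].

Definition empty_decoration N : Hom (unit D) (F N) :=
  fmap F (bang N) ∘ lax_unit F.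

Definition pair_decoration N M (s : Hom (unit D) (F N)) (t : Hom (unit D) (F M)) :
    Hom (unit D) (F (coprod N M)) :=
  lax_mu F N M ∘ (s ⊠ t) ∘ bwd (lunit (unit D)).

Definition cospan_comp X Y Z (c : DecoratedCospan X Y) (d : DecoratedCospan Y Z) :
    DecoratedCospan X Z :=
  let j1 := po1 (cospan_out c) (cospan_in d) in
  let j2 := po2 (cospan_out c) (cospan_in d) in
  MkCospan (j1 ∘ cospan_in c) (j2 ∘ cospan_out d)
    (fmap F (copair j1 j2) ∘ pair_decoration (decoration c) (decoration d)).

Definition cospan_tensor X Y X' Y'
    (c : DecoratedCospan X Y) (d : DecoratedCospan X' Y') :
    DecoratedCospan (coprod X X') (coprod Y Y') :=
  MkCospan (coprodm (cospan_in c) (cospan_in d))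
    (coprodm (cospan_out c) (cospan_out d))
    (pair_decoration (decoration c) (decoration d)).

Definition cospan_of X Y (f : Hom X Y) : DecoratedCospan X Y :=
  MkCospan f (idm Y) (empty_decoration Y).

Definition cospan_op_of X Y (f : Hom X Y) : DecoratedCospan Y X :=
  MkCospan (idm Y) f (empty_decoration Y).

Lemma cospan_iso_refl X Y (c : DecoratedCospan X Y) : cospan_iso c c.
Proof.
by exists (idm _), (idm _); split; rewrite ?comp_idl //;
  split; rewrite ?fmap_id ?comp_idl.
Qed.
Lemma cospan_iso_sym X Y (c d : DecoratedCospan X Y) :
  cospan_iso c d -> cospan_iso d c.
Proof. by move=> [n [m [? ? ? ?]]]; exists m, n. Qed.
Lemma is_cospan_map_comp X Y (c d e : DecoratedCospan X Y)
    (m : Hom (cospan_apex d) (cospan_apex e))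
    (n : Hom (cospan_apex c) (cospan_apex d)) :
  is_cospan_map m -> is_cospan_map n -> @is_cospan_map X Y c e (m ∘ n).
Proof.
move=> [m1 m2 m3] [n1 n2 n3].
split; first by rewrite comp_assoc n1 m1.
  by rewrite comp_assoc n2 m2.
by rewrite -m3 -n3 -comp_assoc -fmap_comp.
Qed.
Lemma cospan_iso_trans X Y (c d e : DecoratedCospan X Y) :
  cospan_iso c d -> cospan_iso d e -> cospan_iso c e.
Proof.
move=> [n [m [n1 m1 mn nm]]] [n' [m' [n1' m1' mn' nm']]].
exists (n' ∘ n), (m ∘ m'); split; do ?exact: is_cospan_map_comp.
  by rewrite comp_assoc -[m' ∘ _]comp_assoc mn' comp_idl mn.
by rewrite comp_assoc -[n ∘ _]comp_assoc nm comp_idl nm'.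
Qed.

(* [generic_quotient] needs a choice type; [boolp] provides the structure
   classically. *)
HB.instance Definition _ X Y := gen_eqMixin (DecoratedCospan X Y).
HB.instance Definition _ X Y := gen_choiceMixin (DecoratedCospan X Y).

Definition cospan_isob X Y : rel (DecoratedCospan X Y) :=
  fun c d => `[< cospan_iso c d >].
Lemma cospan_isob_equiv X Y : equiv_class_of (@cospan_isob X Y).
Proof.
split.
- by move=> c; apply/asboolP/cospan_iso_refl.
- by move=> c d; apply/asboolP/asboolP => /cospan_iso_sym.
- move=> d c e /asboolP h1 /asboolP h2; apply/asboolP.
  exact: cospan_iso_trans h1 h2.
Qed.
Canonical cospan_equiv X Y := EquivRelPack (@cospan_isob_equiv X Y).

Definition CospanClass X Y : Type := {eq_quot (@cospan_equiv X Y)}.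
Definition cospan_class X Y (c : DecoratedCospan X Y) : CospanClass X Y :=
  \pi_({eq_quot (@cospan_equiv X Y)}) c.
Definition cospan_repr X Y (c : CospanClass X Y) : DecoratedCospan X Y :=
  repr (c : {eq_quot (@cospan_equiv X Y)}).

Lemma cospan_classP X Y (c d : DecoratedCospan X Y) :
  cospan_class c = cospan_class d <-> cospan_iso c d.
Proof.
split; first by move=> /eqmodP /asboolP.
by move=> h; apply/eqmodP/asboolP.
Qed.
Lemma cospan_reprK X Y (c : CospanClass X Y) : cospan_class (cospan_repr c) = c.
Proof. exact: reprK. Qed.
Lemma cospan_repr_iso X Y (c : DecoratedCospan X Y) :
  cospan_iso (cospan_repr (cospan_class c)) c.
Proof. by apply/cospan_classP; rewrite cospan_reprK. Qed.

Definition dec N := Hom (unit D) (F N).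
Definition dpush N M (f : Hom N M) (s : dec N) : dec M := fmap F f ∘ s.
Definition dmul N (s t : dec N) : dec N :=
  dpush (copair (idm N) (idm N)) (pair_decoration s t).

Lemma dpush_id N (s : dec N) : dpush (idm N) s = s.
Proof. by rewrite /dpush (fmap_id F N) comp_idl. Qed.
Lemma dpush_comp N M L (g : Hom M L) (f : Hom N M) (s : dec N) :
  dpush g (dpush f s) = dpush (g ∘ f) s.
Proof. by rewrite /dpush (fmap_comp F g f) comp_assoc. Qed.
Lemma dpush_pair N N' M M' (f : Hom N N') (g : Hom M M') (s : dec N) (t : dec M) :
  pair_decoration (dpush f s) (dpush g t) =
  dpush (coprodm f g) (pair_decoration s t).
Proof.
rewrite /pair_decoration /dpush tensorm_comp -!comp_assoc.
by rewrite (lax_mu_nat F f g).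
Qed.
Lemma assoc_lunit :
  assoc (unit D) (unit D) (unit D) ∘ (bwd (lunit (unit D)) ⊠ idm (unit D))
    ∘ bwd (lunit (unit D)) =
  (idm (unit D) ⊠ bwd (lunit (unit D))) ∘ bwd (lunit (unit D)).
Proof.
have e : (idm (unit D) ⊠ lunit (unit D)) ∘ assoc (unit D) (unit D) (unit D)
         = lunit (unit D) ⊠ idm (unit D).
  by rewrite triangle lunit_unit.
have k : (idm (unit D) ⊠ bwd (lunit (unit D))) ∘ (idm (unit D) ⊠ lunit (unit D))
         = idm _.
  by rewrite -tensorm_comp comp_idl fwdK tensorm_id.
rewrite -[fwd (assoc _ _ _)]comp_idl -k [_ ∘ assoc _ _ _]comp_assoc e.
by rewrite !comp_assoc -[(lunit _ ⊠ _) ∘ _]comp_assoc -tensorm_comp comp_idl bwdK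
  tensorm_id comp_idl.
Qed.
Lemma pair_assoc N M L (s : dec N) (t : dec M) (u : dec L) :
  dpush (coassoc_fwd N M L) (pair_decoration (pair_decoration s t) u) =
  pair_decoration s (pair_decoration t u).
Proof.
have a := lax_assoc F N M L; rewrite /= in a.
rewrite /pair_decoration /dpush.
have -> : (lax_mu F N M ∘ (s ⊠ t) ∘ bwd (lunit (unit D))) ⊠ u =
    (lax_mu F N M ⊠ idm (F L)) ∘ ((s ⊠ t) ⊠ u)
      ∘ (bwd (lunit (unit D)) ⊠ idm (unit D)).
  by rewrite -!tensorm_comp comp_idl comp_idr.
have -> : s ⊠ (lax_mu F M L ∘ (t ⊠ u) ∘ bwd (lunit (unit D))) =
    (idm (F N) ⊠ lax_mu F M L) ∘ (s ⊠ (t ⊠ u))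
      ∘ (idm (unit D) ⊠ bwd (lunit (unit D))).
  by rewrite -!tensorm_comp comp_idl comp_idr.
rewrite -!comp_assoc a ![in RHS]comp_assoc -assoc_lunit !comp_assoc.
by rewrite -[fwd (assoc (F _) _ _) ∘ (_ ∘ _)]comp_assoc assoc_nat !comp_assoc.
Qed.
Lemma pair_unitl N (s : dec N) :
  dpush (colunit_fwd N) (pair_decoration (lax_unit F) s) = s.
Proof.
have a := lax_unitl F N; rewrite /= in a.
rewrite /pair_decoration /dpush.
have -> : lax_unit F ⊠ s = (lax_unit F ⊠ idm (F N)) ∘ (idm (unit D) ⊠ s).
  by rewrite -tensorm_comp comp_idl comp_idr.
rewrite -!comp_assoc a lunit_nat comp_assoc bwdK; exact: comp_idr.
Qed.
Lemma pair_braid N M (s : dec N) (t : dec M) :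
  dpush (cobraid_fwd N M) (pair_decoration s t) = pair_decoration t s.
Proof.
have a := lax_braid F N M; rewrite /= in a.
have b : braid (unit D) (unit D) ∘ bwd (lunit (unit D)) = bwd (lunit (unit D)).
  have e : lunit (unit D) ∘ (braid (unit D) (unit D) ∘ bwd (lunit (unit D)))
           = idm _.
    by rewrite -comp_assoc braid_unit -lunit_unit bwdK.
  by rewrite -[RHS]comp_idr -e -comp_assoc fwdK comp_idl.
rewrite /pair_decoration /dpush -!comp_assoc a !comp_assoc.
by rewrite -[fwd (braid (F _) _) ∘ (_ ∘ _)]comp_assoc braid_nat comp_assoc b.
Qed.

Lemma dpush_empty N M (f : Hom N M) :
  dpush f (empty_decoration N) = empty_decoration M.
Proof.
rewrite /empty_decoration (dpush_comp f (bang N)) /dpush.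
by congr (fmap F _ ∘ _); apply: initial_ext.
Qed.
Lemma dpush_copair N M L (f : Hom N L) (g : Hom M L) (s : dec N) (t : dec M) :
  dpush (copair f g) (pair_decoration s t) = dmul (dpush f s) (dpush g t).
Proof.
rewrite /dmul dpush_pair dpush_comp; congr dpush; by coprod_eq.
Qed.
Lemma pair_dmul N M (s : dec N) (t : dec M) :
  pair_decoration s t = dmul (dpush (inl N M) s) (dpush (inr N M) t).
Proof. by rewrite -dpush_copair copair_id dpush_id. Qed.
Lemma dpush_dmul N M (f : Hom N M) (s t : dec N) :
  dpush f (dmul s t) = dmul (dpush f s) (dpush f t).
Proof. by rewrite -dpush_copair /dmul dpush_comp comp_copair !comp_idr. Qed.
Lemma dmulC N (s t : dec N) : dmul s t = dmul t s.
Proof.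
rewrite /dmul -[in RHS]pair_braid dpush_comp; congr dpush; by coprod_eq.
Qed.
Lemma dmul0l N (s : dec N) : dmul (empty_decoration N) s = s.
Proof.
rewrite -[RHS]pair_unitl dpush_copair dpush_id; congr dmul.
Qed.
Lemma dmul0r N (s : dec N) : dmul s (empty_decoration N) = s.
Proof. by rewrite dmulC dmul0l. Qed.
Lemma dmulA N (s t u : dec N) : dmul (dmul s t) u = dmul s (dmul t u).
Proof.
have := pair_assoc s t u.
move/(congr1 (dpush (copair (idm N) (copair (idm N) (idm N))))).
rewrite [RHS]dpush_copair dpush_copair !dpush_id => <-.
rewrite dpush_comp -[u in LHS]dpush_id -[dmul s t in LHS]dpush_id -dpush_copair /dmul.
rewrite -[u in LHS]dpush_id dpush_pair dpush_comp; congr dpush; by coprod_eq.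
Qed.
Lemma dmul_swap N (s t u v : dec N) :
  dmul (dmul s t) (dmul u v) = dmul (dmul s u) (dmul t v).
Proof. by rewrite !dmulA -[dmul t _]dmulA (dmulC t u) dmulA. Qed.

Lemma pushout_ext X Y Z P Q (f : Hom Z X) (g : Hom Z Y) (p : Hom X P) (q : Hom Y P)
    (h k : Hom P Q) :
  is_pushout f g p q -> h ∘ p = k ∘ p -> h ∘ q = k ∘ q -> h = k.
Proof.
move=> [e u] ep eq.
have [|m [_ hu]] := u Q (k ∘ p) (k ∘ q); first by rewrite !comp_assoc e.
by rewrite -(hu h) // -(hu k).
Qed.

Definition comp_along X Y Z P (c : DecoratedCospan X Y) (d : DecoratedCospan Y Z)
    (p : Hom (cospan_apex c) P) (q : Hom (cospan_apex d) P) :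
    DecoratedCospan X Z :=
  MkCospan (p ∘ cospan_in c) (q ∘ cospan_out d)
    (dmul (dpush p (decoration c)) (dpush q (decoration d))).

Lemma cospan_compE X Y Z (c : DecoratedCospan X Y) (d : DecoratedCospan Y Z) :
  cospan_comp c d =
  comp_along (po1 (cospan_out c) (cospan_in d)) (po2 (cospan_out c) (cospan_in d)).
Proof. by rewrite /comp_along -dpush_copair. Qed.

Lemma comp_along_map X Y Z P P' (c c' : DecoratedCospan X Y)
    (d d' : DecoratedCospan Y Z)
    (p : Hom (cospan_apex c) P) (q : Hom (cospan_apex d) P)
    (p' : Hom (cospan_apex c') P') (q' : Hom (cospan_apex d') P') n m :
  is_pushout (cospan_out c) (cospan_in d) p q ->
  is_pushout (cospan_out c') (cospan_in d') p' q' ->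
  @is_cospan_map X Y c c' n -> @is_cospan_map Y Z d d' m ->
  exists h : Hom P P', [/\ h ∘ p = p' ∘ n, h ∘ q = q' ∘ m &
    @is_cospan_map X Z (comp_along p q) (comp_along p' q') h].
Proof.
move=> [e u] [e' u'] [n1 n2 n3] [m1 m2 m3].
have [|h [[h1 h2] _]] := u P' (p' ∘ n) (q' ∘ m).
  by rewrite !comp_assoc n2 m1 e'.
exists h; split => //; split => /=.
- by rewrite -comp_assoc h1 comp_assoc n1.
- by rewrite -comp_assoc h2 comp_assoc m2.
- rewrite -[LHS]/(dpush h _) dpush_dmul !dpush_comp h1 h2 -!dpush_comp.
  by rewrite /dpush n3 m3.
Qed.

Lemma comp_along_iso X Y Z P P' (c c' : DecoratedCospan X Y)
    (d d' : DecoratedCospan Y Z)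
    (p : Hom (cospan_apex c) P) (q : Hom (cospan_apex d) P)
    (p' : Hom (cospan_apex c') P') (q' : Hom (cospan_apex d') P') :
  is_pushout (cospan_out c) (cospan_in d) p q ->
  is_pushout (cospan_out c') (cospan_in d') p' q' ->
  cospan_iso c c' -> cospan_iso d d' ->
  cospan_iso (comp_along p q) (comp_along p' q').
Proof.
move=> po po' [n [n' [n1 n1' n'n nn']]] [m [m' [m1 m1' m'm mm']]].
have [h [h1 h2 h3]] := comp_along_map po po' n1 m1.
have [h' [h1' h2' h3']] := comp_along_map po' po n1' m1'.
exists h, h'; split => //=.
  by apply: (pushout_ext po);
    rewrite comp_assoc ?h1 ?h2 -comp_assoc ?h1' ?h2' comp_assoc ?n'n ?m'm
      comp_idl comp_idr.
by apply: (pushout_ext po');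
  rewrite comp_assoc ?h1' ?h2' -comp_assoc ?h1 ?h2 comp_assoc ?nn' ?mm'
    comp_idl comp_idr.
Qed.

Definition class_comp X Y Z (d : CospanClass Y Z) (c : CospanClass X Y) :
    CospanClass X Z :=
  cospan_class (cospan_comp (cospan_repr c) (cospan_repr d)).

Lemma class_comp_along X Y Z P (c : DecoratedCospan X Y) (d : DecoratedCospan Y Z)
    (p : Hom (cospan_apex c) P) (q : Hom (cospan_apex d) P) :
  is_pushout (cospan_out c) (cospan_in d) p q ->
  class_comp (cospan_class d) (cospan_class c) = cospan_class (comp_along p q).
Proof.
move=> po; apply/cospan_classP; rewrite cospan_compE.
by apply: comp_along_iso po _ _; [exact: pushoutP|exact: cospan_repr_iso..].
Qed.

Lemma class_compE X Y Z (c : DecoratedCospan X Y) (d : DecoratedCospan Y Z) :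
  class_comp (cospan_class d) (cospan_class c) = cospan_class (cospan_comp c d).
Proof. by rewrite cospan_compE; apply: class_comp_along; exact: pushoutP. Qed.

Lemma classW X Y (P : CospanClass X Y -> Prop) :
  (forall c, P (cospan_class c)) -> forall c, P c.
Proof. by move=> h c; rewrite -(cospan_reprK c). Qed.

Lemma class_eq X Y (c d : DecoratedCospan X Y)
    (n : Hom (cospan_apex c) (cospan_apex d))
    (m : Hom (cospan_apex d) (cospan_apex c)) :
  m ∘ n = idm _ -> n ∘ m = idm _ ->
  n ∘ cospan_in c = cospan_in d -> n ∘ cospan_out c = cospan_out d ->
  dpush n (decoration c) = decoration d -> cospan_class c = cospan_class d.
Proof.
move=> mn nm e1 e2 e3; apply/cospan_classP; exists n, m; split => //; split => //.
- by rewrite -e1 -comp_assoc mn comp_idl.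
- by rewrite -e2 -comp_assoc mn comp_idl.
- by rewrite -[LHS]/(dpush m _) -e3 dpush_comp mn dpush_id.
Qed.

Lemma pushout_idl X Y (f : Hom X Y) : is_pushout (idm X) f f (idm Y).
Proof.
split; first by rewrite comp_idl comp_idr.
move=> V p' q'; rewrite comp_idr => ->.
exists q'; split; first by rewrite comp_idr.
by move=> h [_]; rewrite comp_idr.
Qed.
Lemma pushout_idr X Y (f : Hom X Y) : is_pushout f (idm X) (idm Y) f.
Proof.
split; first by rewrite comp_idl comp_idr.
move=> V p' q'; rewrite comp_idr => <-.
exists p'; split; first by rewrite comp_idr.
by move=> h []; rewrite comp_idr.
Qed.

Lemma comp_class_of X Y Z (f : Hom X Y) (c : DecoratedCospan Y Z) :
  class_comp (cospan_class c) (cospan_class (cospan_of f)) =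
  cospan_class (MkCospan (cospan_in c ∘ f) (cospan_out c) (decoration c)).
Proof.
rewrite (@class_comp_along _ _ _ _ (cospan_of f) c _ _ (pushout_idl (cospan_in c))).
by rewrite /comp_along /= comp_idl dpush_empty dmul0l dpush_id.
Qed.
Lemma op_class_comp X Y Z (g : Hom Z Y) (c : DecoratedCospan X Y) :
  class_comp (cospan_class (cospan_op_of g)) (cospan_class c) =
  cospan_class (MkCospan (cospan_in c) (cospan_out c ∘ g) (decoration c)).
Proof.
rewrite (@class_comp_along _ _ _ _ c (cospan_op_of g) _ _
  (pushout_idr (cospan_out c))).
by rewrite /comp_along /= comp_idl dpush_empty dmul0r dpush_id.
Qed.
Lemma of_iso_op X Y (f : Iso X Y) :
  cospan_class (cospan_of f) = cospan_class (cospan_op_of (bwd f)).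
Proof.
apply: (@class_eq _ _ (cospan_of f) (cospan_op_of (bwd f)) (bwd f) f) => /=;
  by rewrite ?fwdK ?bwdK ?comp_idr ?dpush_empty.
Qed.
Lemma of_class_comp X Y Z (f : Iso Y Z) (c : DecoratedCospan X Y) :
  class_comp (cospan_class (cospan_of f)) (cospan_class c) =
  cospan_class (MkCospan (cospan_in c) (cospan_out c ∘ bwd f) (decoration c)).
Proof. by rewrite of_iso_op op_class_comp. Qed.

Definition class_of X Y (f : Hom X Y) : CospanClass X Y :=
  cospan_class (cospan_of f).
Definition class_op_of X Y (f : Hom X Y) : CospanClass Y X :=
  cospan_class (cospan_op_of f).
Definition class_id X : CospanClass X X := class_of (idm X).

Lemma class_idl X Y (c : CospanClass X Y) : class_comp (class_id Y) c = c.
Proof.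
elim/classW: c => c.
by rewrite (op_class_comp (idm Y)) comp_idr; case: c.
Qed.
Lemma class_idr X Y (c : CospanClass X Y) : class_comp c (class_id X) = c.
Proof. by elim/classW: c => c; rewrite comp_class_of comp_idr; case: c. Qed.

Lemma class_assoc X Y Z W (e : CospanClass Z W) (d : CospanClass Y Z)
    (c : CospanClass X Y) :
  class_comp (class_comp e d) c = class_comp e (class_comp d c).
Proof.
elim/classW: c => c; elim/classW: d => d; elim/classW: e => e.
have cd := pushoutP (cospan_out c) (cospan_in d).
have de := pushoutP (cospan_out d) (cospan_in e).
rewrite (class_comp_along cd) (class_comp_along de).
set p := po1 (cospan_out c) _ in cd *; set q := po2 (cospan_out c) _ in cd *.
set p' := po1 _ _ in de *; set q' := po2 _ _ in de *.
have inn := pushoutP q p'; set a := po1 q p' in inn; set b := po2 q p' in inn.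
have P1 : is_pushout (cospan_out c) (p' ∘ cospan_in d) (a ∘ p) b.
  case: inn cd => [i1 i2] [c1 c2]; split.
    by rewrite comp_assoc c1 -!comp_assoc i1.
  move=> V x y xy.
  have [|h [[h1 h2] hu]] := c2 V x (y ∘ p'); first by rewrite xy comp_assoc.
  have [|k [[k1 k2] ku]] := i2 V h y; first by rewrite h2.
  exists k; split; first by rewrite -comp_assoc k1 h1.
  move=> k' [k1' k2']; apply: ku; split => //; apply/esym/hu; split.
    by rewrite comp_assoc.
  by rewrite -k2' !comp_assoc i1.
have P2 : is_pushout (q ∘ cospan_out d) (cospan_in e) a (b ∘ q').
  case: inn de => [i1 i2] [c1 c2]; split.
    by rewrite -comp_assoc i1 !comp_assoc c1.
  move=> V x y xy.
  have [|h [[h1 h2] hu]] := c2 V (x ∘ q) y; first by rewrite -xy comp_assoc.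
  have [|k [[k1 k2] ku]] := i2 V x h; first by rewrite h1.
  exists k; split; first by rewrite -comp_assoc k2 h2.
  move=> k' [k1' k2']; apply: ku; split => //; apply/esym/hu; split.
    by rewrite -k1' !comp_assoc i1.
  by rewrite comp_assoc.
rewrite (@class_comp_along _ _ _ _ c (comp_along p' q') _ _ P1).
rewrite (@class_comp_along _ _ _ _ (comp_along p q) e _ _ P2).
congr cospan_class; rewrite /comp_along /= !comp_assoc !dpush_dmul !dpush_comp dmulA.
by case: inn => ->.
Qed.

Definition DecoratedCospanCat : Category :=
  MkCategory class_idl class_idr class_assoc.

Definition class_tensor X Y X' Y' (c : CospanClass X Y) (d : CospanClass X' Y') :
    CospanClass (coprod X X') (coprod Y Y') :=
  cospan_class (cospan_tensor (cospan_repr c) (cospan_repr d)).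

Lemma class_tensorE X Y X' Y' (c : DecoratedCospan X Y) (d : DecoratedCospan X' Y') :
  class_tensor (cospan_class c) (cospan_class d) = cospan_class (cospan_tensor c d).
Proof.
have [n [m [[n1 n2 n3] _ mn nm]]] := cospan_repr_iso c.
have [n' [m' [[n1' n2' n3'] _ mn' nm']]] := cospan_repr_iso d.
apply: (@class_eq _ _ (cospan_tensor _ _) (cospan_tensor _ _)
  (coprodm n n') (coprodm m m')) => /=.
- by coprod_eq; rewrite ?mn ?mn' ?comp_idr.
- by coprod_eq; rewrite ?nm ?nm' ?comp_idr.
- by rewrite -n1 -n1'; coprod_eq.
- by rewrite -n2 -n2'; coprod_eq.
- by rewrite -dpush_pair /dpush n3 n3'.
Qed.

Lemma tensor_class_of X Y X' Y' (f : Hom X Y) (g : Hom X' Y') :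
  class_tensor (class_of f) (class_of g) = class_of (coprodm f g).
Proof.
rewrite /class_of class_tensorE /cospan_tensor /cospan_of /=.
rewrite pair_dmul !dpush_empty dmul0l; congr (cospan_class (MkCospan _ _ _)).
by coprod_eq.
Qed.
Lemma tensor_class_op_of X Y X' Y' (f : Hom X Y) (g : Hom X' Y') :
  class_tensor (class_op_of f) (class_op_of g) = class_op_of (coprodm f g).
Proof.
rewrite /class_op_of class_tensorE /cospan_tensor /cospan_op_of /=.
rewrite pair_dmul !dpush_empty dmul0l; congr (cospan_class (MkCospan _ _ _)).
by coprod_eq.
Qed.
Lemma comp_class_of_of X Y Z (g : Hom Y Z) (f : Hom X Y) :
  class_comp (class_of g) (class_of f) = class_of (g ∘ f).
Proof. by rewrite /class_of comp_class_of. Qed.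
Lemma comp_class_op_op X Y Z (g : Hom Y Z) (f : Hom X Y) :
  class_comp (class_op_of f) (class_op_of g) = class_op_of (g ∘ f).
Proof. by rewrite /class_op_of op_class_comp. Qed.

Lemma class_tensor_id X Y :
  class_tensor (class_id X) (class_id Y) = class_id (coprod X Y).
Proof. by rewrite tensor_class_of; congr class_of; coprod_eq. Qed.

Lemma pushout_coprod X Y Z P X' Y' Z' P' (f : Hom Z X) (g : Hom Z Y)
    (p : Hom X P) (q : Hom Y P) (f' : Hom Z' X') (g' : Hom Z' Y')
    (p' : Hom X' P') (q' : Hom Y' P') :
  is_pushout f g p q -> is_pushout f' g' p' q' ->
  is_pushout (coprodm f f') (coprodm g g') (coprodm p p') (coprodm q q').
Proof.
move=> [e u] [e' u']; split; first by coprod_eq; rewrite ?e ?e'.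
move=> V x y xy.
have xy1 : x ∘ inl X X' ∘ f = y ∘ inl Y Y' ∘ g.
  move/(congr1 (fun h => h ∘ inl _ _)): xy.
  by rewrite /coprodm !coprodE.
have xy2 : x ∘ inr X X' ∘ f' = y ∘ inr Y Y' ∘ g'.
  move/(congr1 (fun h => h ∘ inr _ _)): xy.
  by rewrite /coprodm !coprodE.
have [h [[h1 h2] hu]] := u _ _ _ xy1.
have [k [[k1 k2] ku]] := u' _ _ _ xy2.
exists (copair h k); split.
  by split; coprod_eq.
move=> l [l1 l2]; apply: coprod_ext.
  rewrite copair_inl; apply: hu; rewrite -l1 -l2 /coprodm; by rewrite !coprodE.
rewrite copair_inr; apply: ku; rewrite -l1 -l2 /coprodm; by rewrite !coprodE.
Qed.

Lemma class_tensor_comp X X' X'' Y Y' Y''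
    (f' : CospanClass X' X'') (f : CospanClass X X')
    (g' : CospanClass Y' Y'') (g : CospanClass Y Y') :
  class_tensor (class_comp f' f) (class_comp g' g) =
  class_comp (class_tensor f' g') (class_tensor f g).
Proof.
elim/classW: f => f; elim/classW: f' => f'; elim/classW: g => g.
elim/classW: g' => g'.
have ff := pushoutP (cospan_out f) (cospan_in f').
have gg := pushoutP (cospan_out g) (cospan_in g').
rewrite (class_comp_along ff) (class_comp_along gg) !class_tensorE.
have fg := pushout_coprod ff gg.
rewrite (@class_comp_along _ _ _ _ (cospan_tensor f g) (cospan_tensor f' g') _ _ fg).
rewrite /comp_along /cospan_tensor /=; congr (cospan_class (MkCospan _ _ _)).
- by coprod_eq.
- by coprod_eq.
- rewrite !pair_dmul !dpush_dmul !dpush_comp /coprodm !copair_inl !copair_inr.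
  exact: dmul_swap.
Qed.

Lemma class_of_isoK X Y (f : Iso X Y) :
  class_comp (class_of (bwd f)) (class_of f) = class_id X.
Proof. by rewrite comp_class_of_of fwdK. Qed.
Lemma class_of_isoVK X Y (f : Iso X Y) :
  class_comp (class_of f) (class_of (bwd f)) = class_id Y.
Proof. by rewrite comp_class_of_of bwdK. Qed.
Definition iso_of X Y (f : Iso X Y) : @Iso DecoratedCospanCat X Y :=
  @MkIso DecoratedCospanCat X Y _ _ (class_of_isoK f) (class_of_isoVK f).

Lemma class_assoc_nat X X' Y Y' Z Z' (f : CospanClass X X') (g : CospanClass Y Y')
    (h : CospanClass Z Z') :
  class_comp (class_of (coassoc X' Y' Z')) (class_tensor (class_tensor f g) h) =
  class_comp (class_tensor f (class_tensor g h)) (class_of (coassoc X Y Z)).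
Proof.
elim/classW: f => f; elim/classW: g => g; elim/classW: h => h.
rewrite !class_tensorE of_class_comp comp_class_of.
apply: (@class_eq _ _ (MkCospan _ _ _) (MkCospan _ _ _)
  (coassoc _ _ _) (bwd (coassoc _ _ _))) => /=; [by coprod_eq..|].
exact: pair_assoc.
Qed.
Lemma class_lunit_nat X X' (f : CospanClass X X') :
  class_comp (class_of (colunit X')) (class_tensor (class_id (initial C)) f) =
  class_comp f (class_of (colunit X)).
Proof.
elim/classW: f => f.
rewrite class_tensorE of_class_comp comp_class_of.
apply: (@class_eq _ _ (MkCospan _ _ _) (MkCospan _ _ _)
  (colunit _) (bwd (colunit _))) => /=; [by coprod_eq..|].
by rewrite dpush_copair dpush_empty dpush_id dmul0l.
Qed.
Lemma class_runit_nat X X' (f : CospanClass X X') :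
  class_comp (class_of (corunit X')) (class_tensor f (class_id (initial C))) =
  class_comp f (class_of (corunit X)).
Proof.
elim/classW: f => f.
rewrite class_tensorE of_class_comp comp_class_of.
apply: (@class_eq _ _ (MkCospan _ _ _) (MkCospan _ _ _)
  (corunit _) (bwd (corunit _))) => /=; [by coprod_eq..|].
by rewrite dpush_copair dpush_empty dpush_id dmul0r.
Qed.
Lemma class_braid_nat X X' Y Y' (f : CospanClass X X') (g : CospanClass Y Y') :
  class_comp (class_of (cobraid X' Y')) (class_tensor f g) =
  class_comp (class_tensor g f) (class_of (cobraid X Y)).
Proof.
elim/classW: f => f; elim/classW: g => g.
rewrite !class_tensorE of_class_comp comp_class_of.
apply: (@class_eq _ _ (MkCospan _ _ _) (MkCospan _ _ _)
  (cobraid _ _) (bwd (cobraid _ _))) => /=; [by coprod_eq..|].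
exact: pair_braid.
Qed.

Definition classE := (class_tensor_id, tensor_class_of, comp_class_of_of,
  tensor_class_op_of, comp_class_op_op).

Definition DecoratedCospanMonoidal : MonoidalCategory.
Proof.
refine (@MkMonoidal DecoratedCospanCat (initial C) (@coprod C) class_tensor
  class_tensor_id class_tensor_comp
  (fun X Y Z => iso_of (coassoc X Y Z)) (fun X => iso_of (colunit X))
  (fun X => iso_of (corunit X))
  class_assoc_nat class_lunit_nat class_runit_nat _ _ _) => * /=;
  rewrite /class_id ?classE; congr class_of; by coprod_eq.
Defined.

Definition DecoratedCospanBraided : BraidedCategory.
Proof.
refine (@MkBraided DecoratedCospanMonoidal (fun X Y => iso_of (cobraid X Y))
  class_braid_nat _ _ _) => * /=;
  rewrite /class_id ?classE; congr class_of; by coprod_eq.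
Defined.

Definition DecoratedCospanSymmetric : SymmetricCategory.
Proof.
refine (@MkSymmetric DecoratedCospanBraided _) => * /=;
  rewrite /class_id ?classE; congr class_of; by coprod_eq.
Defined.

Definition codiag X : Hom (coprod X X) X := copair (idm X) (idm X).

Lemma class_op_id X : class_op_of (idm X) = class_id X.
Proof. by []. Qed.

Lemma class_of_isoE X Y (f : Iso X Y) : class_of f = class_op_of (bwd f).
Proof. exact: of_iso_op. Qed.
Lemma class_of_isoVE X Y (f : Iso X Y) : class_of (bwd f) = class_op_of f.
Proof. exact: (of_iso_op (MkIso (bwdK f) (fwdK f))). Qed.

Lemma class_of_op X Y Z P (f : Hom Z X) (g : Hom Z Y) (p : Hom X P) (q : Hom Y P) :
  is_pushout f g p q ->
  class_comp (class_of g) (class_op_of f) = class_comp (class_op_of q) (class_of p).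
Proof.
move=> po.
rewrite (@class_comp_along _ _ _ _ (cospan_op_of f) (cospan_of g) _ _ po).
rewrite /class_of /class_op_of (op_class_comp q (cospan_of p)).
by rewrite /comp_along /= !dpush_empty dmul0l comp_idl !comp_idr.
Qed.

Definition DecoratedCospanFrobenius X :
  @SpecialCommFrobenius DecoratedCospanSymmetric X.
Proof.
refine (@MkFrobenius DecoratedCospanSymmetric X
  (class_of (codiag X)) (class_of (bang X))
  (class_op_of (codiag X)) (class_op_of (bang X))
  _ _ _ _ _ _ _ _ _ _ _) => /=.
- by rewrite /class_id ?classE; congr class_of; rewrite /codiag; coprod_eq.
- by rewrite /class_id ?classE; congr class_of; rewrite /codiag; coprod_eq.
- by rewrite /class_id ?classE; congr class_of; rewrite /codiag; coprod_eq.
- by rewrite /class_id ?classE; congr class_of; rewrite /codiag; coprod_eq.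
- rewrite -?class_op_id (class_of_isoE (coassoc X X X)) !classE.
  by congr class_op_of; rewrite /codiag; coprod_eq.
- rewrite -?class_op_id (class_of_isoE (colunit X)) !classE.
  by congr class_op_of; rewrite /codiag; coprod_eq.
- rewrite -?class_op_id (class_of_isoE (corunit X)) !classE.
  by congr class_op_of; rewrite /codiag; coprod_eq.
- rewrite -?class_op_id (class_of_isoE (cobraid X X)) !classE.
  by congr class_op_of; rewrite /codiag; coprod_eq.
- rewrite -{2}class_op_id /class_id !classE; apply: class_of_op; split.
    by rewrite /codiag; coprod_eq.
  move=> V x y xy.
  have e1 : x ∘ inl X X = y ∘ inl X X.
    move/(congr1 (fun h => h ∘ (inl _ _ ∘ inl _ _))): xy.
    by rewrite /codiag /coprodm /coassoc_fwd !coprodE.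
  have e2 : x ∘ inl X X = y ∘ inr X X.
    move/(congr1 (fun h => h ∘ (inl _ _ ∘ inr _ _))): xy.
    by rewrite /codiag /coprodm /coassoc_fwd !coprodE.
  have e3 : x ∘ inr X X = y ∘ inr X X.
    move/(congr1 (fun h => h ∘ inr _ _)): xy.
    by rewrite /codiag /coprodm /coassoc_fwd !coprodE.
  exists (x ∘ inl X X); split.
    split; rewrite /codiag; coprod_eq; by rewrite -?e1 ?e2 ?e3.
  move=> h [h1 _]; rewrite -h1 /codiag; by rewrite !coprodE.
- rewrite -{2}class_op_id /class_id !classE; apply: class_of_op; split.
    by rewrite /codiag; coprod_eq.
  move=> V x y xy.
  have e1 : x ∘ inl X X = y ∘ inl X X.
    move/(congr1 (fun h => h ∘ inl _ _)): xy.
    by rewrite /codiag /coprodm /coassoc_bwd !coprodE.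
  have e2 : x ∘ inr X X = y ∘ inl X X.
    move/(congr1 (fun h => h ∘ (inr _ _ ∘ inl _ _))): xy.
    by rewrite /codiag /coprodm /coassoc_bwd !coprodE.
  have e3 : x ∘ inr X X = y ∘ inr X X.
    move/(congr1 (fun h => h ∘ (inr _ _ ∘ inr _ _))): xy.
    by rewrite /codiag /coprodm /coassoc_bwd !coprodE.
  exists (x ∘ inl X X); split.
    split; rewrite /codiag; coprod_eq; by rewrite -?e3 ?e2 ?e1.
  move=> h [h1 _]; rewrite -h1 /codiag; by rewrite !coprodE.
- rewrite (@class_of_op _ _ _ _ _ _ (idm X) (idm X)); last first.
    split => // V x y; rewrite /codiag !coprodE => xy.
    have {}xy : x = y.
      by move/(congr1 (fun h => h ∘ inl _ _)): xy; rewrite !coprodE.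
    exists x; split; first by rewrite comp_idr.
    by move=> h []; rewrite comp_idr.
  by rewrite class_op_id class_idl.
Defined.

Definition DecoratedCospanHypergraph : HypergraphCategory.
Proof.
refine (@MkHypergraph DecoratedCospanSymmetric DecoratedCospanFrobenius _ _ _ _)
  => X Y /=.
- rewrite /mid_swap /= /class_id !classE.
  by congr class_of; rewrite /codiag; coprod_eq.
- rewrite /class_id ?classE; congr class_of; by coprod_eq.
- rewrite /mid_swap /= -!class_op_id (class_of_isoE (coassoc X X _))
    (class_of_isoVE (coassoc X Y _)) (class_of_isoE (coassoc _ _ _))
    (class_of_isoVE (coassoc _ _ _)) (class_of_isoE (cobraid _ _)) !classE.
  by congr class_op_of; rewrite /codiag; coprod_eq.
- rewrite (class_of_isoE (colunit (initial C))) !classE.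
  by congr class_op_of; coprod_eq.
Defined.

End DecoratedCospan.
Arguments MkCospan {C D} F {X Y cospan_apex} cospan_in cospan_out decoration.
Arguments cospan_class {C D F X Y} c.

(* Main.v *)
From mathcomp Require Import ssreflect ssrfun ssrbool.
Require Import Defs.
Local Open Scope cat_scope.

Set Implicit Arguments.
Unset Strict Implicit.
Unset Printing Implicit Defensive.

(** The functor [T] applies [A] to the cospan and turns a decoration [s] into
    [θ_N ∘ Bs ∘ β_1]; everything rests on two observations.

    Composition, tensor and the structure maps of a decorated cospan category
    use decorations only through three operations: pushing along a morphism
    of [C], the empty decoration, and the juxtaposition of two decorations.
    The assignment [s ↦ θ_N ∘ Bs ∘ β_1] commutes with each of them: the first
    by naturality of [θ] ([transport_dpush]), the second by its unit axiom
    ([transport_empty]), the third, up to [α], by its multiplicativity and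
    because [B] takes juxtaposed points to juxtaposed points
    ([transport_pair], [lax_point_pair]).  Hence it preserves
    the products [dmul] decorating composites ([transport_dmul]), and as [A]
    preserves pushouts ([preserves_pushout]), [T] is a functor.

    The coherence data of [T] are the images of the isomorphisms [α] and [α_1]
    under the embedding [class_of] of [C'] into [G]-decorated cospans.
    Morphisms of [C] and their reflections are sent by [T] to the images under
    [A] ([map_class_of], [map_class_op_of]), so each coherence law and each
    hypergraph condition is the image under [class_of], or its reflection, of
    the same law for [(A, α)].  Naturality of the multiplication
    ([map_class_tensor]) is the only law that sees the decorations.

    The embedding [class_of] is the identity on objects and is faithful: a map
    of cospans with identity right legs is itself an identity
    ([class_of_inj]).  Hence [class_of α] is an identity exactly when [α] is,
    which gives the equivalence of the two strictness conditions. *)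

(** * Decorated cospans of undecorated origin *)

Section ClassOf.
Context {C : FinCocompleteCategory} {D : BraidedCategory}.
Variable F : LaxBraidedFunctor (coproduct C) D.
Implicit Types X Y : C.

(** An isomorphism between the cospans of [f] and of [g] has to commute with
    their identity right legs, so it is the identity. *)
Lemma class_of_inj X Y (f g : Hom X Y) : class_of F f = class_of F g -> f = g.
Proof.
move=> /cospan_classP [n [_ [[/= nf n1 _] _ _ _]]].
by rewrite -nf; move: n1; rewrite comp_idr => ->; rewrite comp_idl.
Qed.

(** Both structures have the objects of [C], so an equality of objects casts
    an identity of [C] and its class alike. *)
Lemma class_of_hom_cast X Y (e : X = Y) :
  class_of F (hom_cast erefl e (idm X)) =
  hom_cast (C := DecoratedCospanCat F) erefl e (class_id F X).
Proof. by case: Y / e. Qed.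

End ClassOf.

(** * Preservation of pushouts *)

Section PreservesPushout.
Variables (C C' : FinCocompleteCategory) (A : Functor C C').
Hypothesis hA : preserves_finite_colimits A.

Lemma pushout_colimit (Z X Y P : C) (f : Hom Z X) (g : Hom Z Y)
    (p : Hom X P) (q : Hom Y P) (po : is_pushout f g p q) :
  is_colimit (span_cocone (proj1 po)).
Proof.
case: (po) => e u c'.
have l1 := @leg_comp _ _ _ c' None (Some true) isT.
have l2 := @leg_comp _ _ _ c' None (Some false) isT.
have [|h [[h1 h2] hu]] := u c' (leg c' (Some true)) (leg c' (Some false)).
  by rewrite [LHS]l1 [RHS]l2.
exists h; split; first case=> [[]|] //=.
  by rewrite -comp_assoc h1 -l1.
move=> h' h'E; apply: hu; split.
  exact: (h'E (Some true)).
exact: (h'E (Some false)).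
Qed.

Lemma preserves_pushout (Z X Y P : C) (f : Hom Z X) (g : Hom Z Y)
    (p : Hom X P) (q : Hom Y P) :
  is_pushout f g p q -> is_pushout (fmap A f) (fmap A g) (fmap A p) (fmap A q).
Proof.
move=> po; have col := hA (pushout_colimit po).
split; first by rewrite -!fmap_comp (proj1 po).
move=> V p' q' e.
(* The map out of the vertex [None] of the span is forced by the other two. *)
pose l (x : option bool) : Hom (functor_comp A (span_diagram f g) x) V :=
  match x with None => p' ∘ fmap A f | Some true => p' | Some false => q' end.
have lE j k (h : @Hom SpanCat j k) :
  l k ∘ fmap (functor_comp A (span_diagram f g)) h = l j.
  by case: j k h => [[]|] [[]|] h //; rewrite /= ?fmap_id ?comp_idr.
have [h [hE hu]] := col (MkCocone lE).
exists h; split.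
  by split; [exact: (hE (Some true))|exact: (hE (Some false))].
move=> h' [h1 h2]; apply: hu; case=> [[]|] //=.
by rewrite fmap_comp -comp_assoc h1.
Qed.

End PreservesPushout.

(** * Points under a lax monoidal functor *)

Section LaxPoint.
Variables (M N : MonoidalCategory) (B : LaxMonoidalFunctor M N).

(** The left unit law at the unit object, solved for [B λ⁻¹]: this is what
    turns one copy of the unit map into two. *)
Lemma lax_unit_double :
  fmap B (bwd (lunit (unit M))) ∘ lax_unit B =
  lax_mu B (unit M) (unit M) ∘ (lax_unit B ⊠ lax_unit B)
    ∘ bwd (lunit (unit N)).
Proof.
have k : lunit (B (unit M)) ∘ (idm (unit N) ⊠ lax_unit B)
    ∘ bwd (lunit (unit N)) = lax_unit B.
  by rewrite lunit_nat comp_assoc bwdK comp_idr.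
have split_unit : lax_unit B ⊠ lax_unit B =
    (lax_unit B ⊠ idm (B (unit M))) ∘ (idm (unit N) ⊠ lax_unit B).
  by rewrite -tensorm_comp comp_idl comp_idr.
rewrite -{1}k -lax_unitl split_unit !comp_assoc.
by rewrite -[LHS]comp_assoc -fmap_comp fwdK fmap_id comp_idl.
Qed.

Lemma lax_point_pair (X Y : M) (s : Hom (unit M) X) (t : Hom (unit M) Y) :
  fmap B ((s ⊠ t) ∘ bwd (lunit (unit M))) ∘ lax_unit B =
  lax_mu B X Y ∘ ((fmap B s ∘ lax_unit B) ⊠ (fmap B t ∘ lax_unit B))
    ∘ bwd (lunit (unit N)).
Proof.
rewrite fmap_comp comp_assoc lax_unit_double tensorm_comp.
by rewrite -!comp_assoc lax_mu_nat.
Qed.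

End LaxPoint.

(** * Transport of decorations *)

Section Transport.
Variables (C C' : FinCocompleteCategory) (D D' : BraidedCategory).
Variable F : LaxBraidedFunctor (coproduct C) D.
Variable G : LaxBraidedFunctor (coproduct C') D'.
Variables (A : Functor C C') (hA : preserves_finite_colimits A).
Variable B : LaxMonoidalFunctor D D'.
Variable theta : MonoidalTransformation
  (lax_comp B F) (lax_comp G (coproduct_functor hA)).
Implicit Types X Y Z N M : C.

Definition transport N (s : dec F N) : dec G (A N) :=
  theta N ∘ (fmap B s ∘ lax_unit B).

Lemma transport_dpush N M (f : Hom N M) (s : dec F N) :
  transport (dpush f s) = dpush (fmap A f) (transport s).
Proof.
have nat : theta M ∘ fmap B (fmap F f) = fmap G (fmap A f) ∘ theta N :=
  component_nat theta f.
rewrite /transport /dpush fmap_comp.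
rewrite [X in theta M ∘ X]comp_assoc.
rewrite -[LHS]comp_assoc.
rewrite nat.
exact: comp_assoc.
Qed.

Lemma transport_empty N :
  transport (empty_decoration F N) = empty_decoration G (A N).
Proof.
have u := component_unit theta; rewrite /= /lax_comp_unit /= in u.
rewrite -[empty_decoration F N]/(dpush (bang N) (lax_unit F)) transport_dpush.
rewrite /transport u -[_ ∘ lax_unit G]/(dpush _ (lax_unit G)) dpush_comp.
by congr dpush; apply: initial_ext.
Qed.

Lemma transport_pair N M (s : dec F N) (t : dec F M) :
  transport (pair_decoration s t) =
  dpush (alpha A N M) (pair_decoration (transport s) (transport t)).
Proof.
have m : theta (coprod N M) ∘ (fmap B (lax_mu F N M) ∘ lax_mu B (F N) (F M)) =
    (fmap G (alpha A N M) ∘ lax_mu G (A N) (A M)) ∘ (theta N ⊠ theta M) :=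
  component_mu theta N M.
rewrite /transport /pair_decoration /dpush.
rewrite [lax_mu F N M ∘ _ ∘ _]comp_assoc fmap_comp.
rewrite [X in theta _ ∘ X]comp_assoc lax_point_pair.
rewrite [X in lax_mu G _ _ ∘ X]tensorm_comp.
set p := (fmap B s ∘ _) ⊠ _.
rewrite [lax_mu B _ _ ∘ _ ∘ _]comp_assoc.
rewrite -[X in theta _ ∘ X]comp_assoc -[LHS]comp_assoc m.
rewrite [LHS]comp_assoc [LHS]comp_assoc.
by rewrite [X in _ = _ ∘ X]comp_assoc [X in _ = _ ∘ (_ ∘ X)]comp_assoc.
Qed.

Lemma transport_dmul N (s t : dec F N) :
  transport (dmul s t) = dmul (transport s) (transport t).
Proof.
rewrite /dmul transport_dpush transport_pair dpush_comp; congr dpush.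
by rewrite /alpha comp_copair -!fmap_comp copair_inl copair_inr fmap_id.
Qed.

(** * The functor on decorated cospans *)

Definition map_cospan X Y (c : DecoratedCospan F X Y) :
    DecoratedCospan G (A X) (A Y) :=
  MkCospan G (fmap A (cospan_in c)) (fmap A (cospan_out c))
    (transport (decoration c)).

Definition map_class X Y (c : CospanClass F X Y) : CospanClass G (A X) (A Y) :=
  cospan_class (map_cospan (cospan_repr c)).

Lemma map_classE X Y (c : DecoratedCospan F X Y) :
  map_class (cospan_class c) = cospan_class (map_cospan c).
Proof.
have [n [m [[n1 n2 n3] _ mn nm]]] := cospan_repr_iso c.
apply: (@class_eq _ _ _ _ _ (map_cospan _) (map_cospan _) (fmap A n) (fmap A m))
  => /=.
- by rewrite -fmap_comp mn fmap_id.
- by rewrite -fmap_comp nm fmap_id.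
- by rewrite -fmap_comp n1.
- by rewrite -fmap_comp n2.
- by rewrite -transport_dpush /dpush n3.
Qed.

Lemma map_class_of X Y (f : Hom X Y) :
  map_class (class_of F f) = class_of G (fmap A f).
Proof.
by rewrite /class_of map_classE /map_cospan /= fmap_id transport_empty.
Qed.

Lemma map_class_op_of X Y (f : Hom X Y) :
  map_class (class_op_of F f) = class_op_of G (fmap A f).
Proof.
by rewrite /class_op_of map_classE /map_cospan /= fmap_id transport_empty.
Qed.

Lemma map_class_id X : map_class (class_id F X) = class_id G (A X).
Proof. by rewrite map_class_of fmap_id. Qed.

(** Composites may be computed along any pushout, in particular along the image
    under [A] of the one chosen in [C]. *)
Lemma map_class_comp X Y Z (d : CospanClass F Y Z) (c : CospanClass F X Y) :
  map_class (class_comp d c) = class_comp (map_class d) (map_class c).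
Proof.
elim/classW: c => c; elim/classW: d => d.
have po := pushoutP (cospan_out c) (cospan_in d).
rewrite (class_comp_along po) !map_classE.
rewrite (@class_comp_along _ _ _ _ _ _ _ (map_cospan c) (map_cospan d) _ _
  (preserves_pushout hA po)).
rewrite /map_cospan /comp_along /= !fmap_comp.
by rewrite transport_dmul !transport_dpush.
Qed.

Definition map_functor : Functor (DecoratedCospanCat F) (DecoratedCospanCat G) :=
  @MkFunctor (DecoratedCospanCat F) (DecoratedCospanCat G) A map_class
    map_class_id map_class_comp.

Definition alpha_iso X Y : Iso (coprod (A X) (A Y)) (A (coprod X Y)) :=
  MkIso (alphaK hA X Y) (alpha_invK hA X Y).

Definition alpha_unit_iso : Iso (initial C') (A (initial C)) :=
  MkIso (alpha_unitK hA) (alpha_unit_invK hA).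

Lemma map_class_tensor X X' Y Y' (f : CospanClass F X X')
    (g : CospanClass F Y Y') :
  class_comp (class_of G (alpha_iso X' Y'))
    (class_tensor (map_class f) (map_class g)) =
  class_comp (map_class (class_tensor f g)) (class_of G (alpha_iso X Y)).
Proof.
elim/classW: f => f; elim/classW: g => g.
rewrite class_tensorE !map_classE class_tensorE of_class_comp comp_class_of.
have nat U U' V V' (h : Hom U U') (k : Hom V V') :
    alpha A U' V' ∘ coprodm (fmap A h) (fmap A k) =
    fmap A (coprodm h k) ∘ alpha A U V.
  exact: (lax_mu_nat (coproduct_functor hA) h k).
apply: (@class_eq _ _ _ _ _ (MkCospan _ _ _ _) (MkCospan _ _ _ _)
  (alpha_iso _ _) (bwd (alpha_iso _ _))) => /=.
- exact: alphaK.
- exact: alpha_invK.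
- exact: nat.
- by rewrite -comp_assoc nat comp_assoc alpha_invK comp_idr.
- by rewrite transport_pair.
Qed.

(** * The hypergraph structure *)

Definition map_lax :
  LaxMonoidalFunctor (DecoratedCospanMonoidal F) (DecoratedCospanMonoidal G).
Proof.
refine (@MkLax (DecoratedCospanMonoidal F) (DecoratedCospanMonoidal G)
  map_functor (fun X Y => class_of G (alpha_iso X Y))
  (class_of G alpha_unit_iso) map_class_tensor _ _ _) => * /=;
  rewrite map_class_of /class_id !classE; congr class_of.
- exact: (lax_assoc (coproduct_functor hA)).
- exact: (lax_unitl (coproduct_functor hA)).
- exact: (lax_unitr (coproduct_functor hA)).
Defined.

Definition map_braided :
  LaxBraidedFunctor (DecoratedCospanBraided F) (DecoratedCospanBraided G).
Proof.
refine (@MkLaxBraided (DecoratedCospanBraided F) (DecoratedCospanBraided G)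
  map_lax _) => X Y /=.
rewrite map_class_of !classE; congr class_of.
exact: (lax_braid (coproduct_functor hA)).
Defined.

Definition map_strong :
  StrongSymmetricFunctor (DecoratedCospanSymmetric F) (DecoratedCospanSymmetric G).
Proof.
refine (@MkStrong (DecoratedCospanSymmetric F) (DecoratedCospanSymmetric G)
  map_braided (fun X Y => class_of G (bwd (alpha_iso X Y)))
  (class_of G (bwd alpha_unit_iso)) _ _ _ _) => * /=.
- exact: (class_of_isoK G (alpha_iso _ _)).
- exact: (class_of_isoVK G (alpha_iso _ _)).
- exact: (class_of_isoK G alpha_unit_iso).
- exact: (class_of_isoVK G alpha_unit_iso).
Defined.

Lemma codiag_alpha X : fmap A (codiag X) ∘ alpha A X X = codiag (A X).
Proof.
by rewrite /codiag /alpha comp_copair -!fmap_comp copair_inl copair_inr fmap_id.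
Qed.

(** The comonoid conditions are the reflections of the monoid conditions: the
    class of [α⁻¹] is the reflected class of [α]. *)
Definition map_hypergraph :
  HypergraphFunctor (DecoratedCospanHypergraph F) (DecoratedCospanHypergraph G).
Proof.
refine (@MkHypergraphFunctor (DecoratedCospanHypergraph F)
  (DecoratedCospanHypergraph G) map_strong _ _ _ _) => X /=.
- by rewrite map_class_of classE codiag_alpha.
- rewrite map_class_op_of (class_of_isoVE G (alpha_iso X X)) classE.
  by rewrite codiag_alpha.
- by rewrite map_class_of classE; congr class_of; apply: initial_ext.
- rewrite map_class_op_of (class_of_isoVE G alpha_unit_iso) classE.
  by congr class_op_of; apply: initial_ext.
Defined.

Lemma map_hypergraph_strict :
  is_strict map_hypergraph <-> is_strict (coproduct_functor hA).
Proof.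
split=> -[hmu [e1 h1]]; split=> [X Y|].
- have [e h] := hmu X Y; exists e.
  by apply: (class_of_inj (F := G)); rewrite class_of_hom_cast.
- by exists e1; apply: (class_of_inj (F := G)); rewrite class_of_hom_cast.
- have [e h] := hmu X Y; exists e.
  rewrite -[RHS]/(hom_cast (C := DecoratedCospanCat G) erefl e (class_id G _)).
  by rewrite -class_of_hom_cast -h.
- exists e1.
  rewrite -[RHS]/(hom_cast (C := DecoratedCospanCat G) erefl e1 (class_id G _)).
  by rewrite -class_of_hom_cast -h1.
Qed.

End Transport.

Theorem theorem4p1
  (C C' : FinCocompleteCategory) (D D' : BraidedCategory)
  (F : LaxBraidedFunctor (coproduct C) D)
  (G : LaxBraidedFunctor (coproduct C') D')
  (A : Functor C C') (hA : preserves_finite_colimits A)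
  (B : LaxMonoidalFunctor D D')
  (theta : MonoidalTransformation
             (lax_comp B F) (lax_comp G (coproduct_functor hA))) :
  exists (T : HypergraphFunctor (DecoratedCospanHypergraph F)
                                (DecoratedCospanHypergraph G))
         (eT : forall X : C, T X = A X),
    (forall (X Y N : C) (i : Hom X N) (o : Hom Y N) (s : Hom (unit D) (F N)),
       hom_cast (eT X) (eT Y) (fmap T (cospan_class (MkCospan F i o s))) =
       cospan_class
         (MkCospan G (fmap A i) (fmap A o)
            (theta N ∘ (fmap B s ∘ lax_unit B)))) /\
    (is_strict T <-> is_strict (coproduct_functor hA)).
Proof.
exists (map_hypergraph theta), (fun X => erefl); split.
  by move=> X Y N i o s; exact: (map_classE theta (MkCospan F i o s)).
exact: map_hypergraph_strict.
Qed.
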